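(* The group $T_\tau$ has the presentation with generators $x_n,y_n$ ($n\ge 0$) and $c_n$ ($n\ge 1$) (standing for the elements of $T_\tau$ with these names) and with defining relations, for all indices for which the generators occurring are defined: (1.1) $x_jx_i=x_ix_{j+1}$ if $i<j$; (1.2) $x_jy_i=y_ix_{j+1}$ if $i<j$; (1.3) $y_jx_i=x_iy_{j+1}$ if $i<j$; (1.4) $y_jy_i=y_iy_{j+1}$ if $i<j$; (1.5) $y_n^2=x_nx_{n+1}$; (2.1) $x_kc_{n+1}=c_nx_{k+1}$ if $k<n$; (2.2) $c_nx_0=c_{n+1}^2$; (2.3) $c_n=x_nc_{n+1}$; (2.4) $c_n^{n+2}=1$; (3.1) $y_kc_{n+1}=c_ny_{k+1}$ if $k<n$; (3.2) $c_ny_0=y_{n+1}^{-1}c_{n+1}^2$.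
   Context: Let $\tau=(\sqrt5-1)/2$, so $1=\tau+\tau^2$. $V_\tau$ is the group (under composition, $fg=f\circ g$) of left-continuous piecewise-linear bijections of $(0,1]$ with finitely many breakpoints (including discontinuities), all in $\mathbb Z[\tau]$, and all slopes integer powers of $\tau$. $T_\tau$ is the subgroup of those elements of $V_\tau$ which induce orientation-preserving homeomorphisms of the circle obtained from $[0,1]$ by identifying $0$ and $1$. Trees. An $x$-caret subdivides an interval $(a,a+L]$ into $(a,a+\tau^2L]$ and $(a+\tau^2L,a+L]$; a $y$-caret subdivides it into $(a,a+\tau L]$ and $(a+\tau L,a+L]$. A tree is a finite rooted binary tree whose interior nodes (carets) are each of type $x$ or $y$; with root $(0,1]$, its leaves, ordered from left to right, give a subdivision of $(0,1]$. A triple $(T_1,\pi,T_2)$, with $T_1,T_2$ trees with $k$ leaves and $\pi$ a permutation of the $k$ leaf positions, represents the element of $V_\tau$ mapping the interval of leaf $i$ of $T_2$ affinely and increasingly onto the interval of leaf $\pi(i)$ of $T_1$; thus $(T_1,\pi,T_2)(T_2,\pi',T_3)=(T_1,\pi\circ\pi',T_3)$. Generators. The spine $S_m$ is the tree with $m$ $x$-carets, each one after the first attached to the right leg of the previous one; its leaves are numbered $0,1,\dots,m$ from left to right. For $n\ge0$, $x_n$ (resp. $y_n$) is the element $(T,\mathrm{id},S_{n+2})$, where $T$ is obtained from $S_{n+1}$ by attaching an $x$-caret (resp. a $y$-caret) to its leaf number $n$. For $n\ge1$, $c_n=(S_{n+1},\gamma,S_{n+1})$, where $\gamma$ is the cyclic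 permutation sending leaf $0$ to leaf $n+1$ and leaf $i$ to leaf $i-1$ for $1\le i\le n+1$. *)

(* Defs.v *)
From HB Require Import structures.
From mathcomp Require Import all_boot all_order all_algebra all_fingroup.
From mathcomp Require Import all_classical all_reals all_analysis.
From mathcomp Require Import lra.
Set Implicit Arguments.
Unset Strict Implicit.
Unset Printing Implicit Defensive.
Import Order.TTheory GRing.Theory Num.Theory.
Import numFieldNormedType.Exports.

Local Open Scope classical_set_scope.
Local Open Scope quotient_scope.
Local Open Scope ring_scope.

Record selfbij (T : Type) := SelfBij {
  sb_fun :> T -> T;
  sb_inv : T -> T;
  sb_funK : cancel sb_fun sb_inv;
  sb_invK : cancel sb_inv sb_fun }.

Section SelfBijGroup.
Variable T : Type.
Implicit Types f g h : selfbij T.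

Lemma selfbij_ext f g : sb_fun f =1 sb_fun g -> f = g.
Proof.
case: f g => [f f' fK f'K] [g g' gK g'K] /= /funext efg.
case: _ / efg gK g'K => gK g'K.
have ef' : f' = g' by apply: funext => y; rewrite -{1}(g'K y) fK.
case: _ / ef' gK g'K => gK g'K.
by congr SelfBij; exact: Prop_irrelevance.
Qed.

(* f * g is the composite f \o g, so the right factor is applied first. *)
Definition selfbij_mul f g :=
  SelfBij (can_comp (sb_funK f) (sb_funK g))
          (can_comp (sb_invK g) (sb_invK f)).
Definition selfbij_one := @SelfBij T id id (fun=> erefl) (fun=> erefl).
Definition selfbij_inv f := SelfBij (sb_invK f) (sb_funK f).

HB.instance Definition _ := gen_eqMixin (selfbij T).
HB.instance Definition _ := gen_choiceMixin (selfbij T).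

Lemma selfbij_mulA : associative selfbij_mul.
Proof. by move=> f g h; exact: selfbij_ext. Qed.
Lemma selfbij_1mul : left_id selfbij_one selfbij_mul.
Proof. by move=> f; exact: selfbij_ext. Qed.
Lemma selfbij_mul1 : right_id selfbij_one selfbij_mul.
Proof. by move=> f; exact: selfbij_ext. Qed.
Lemma selfbij_Vmul : left_inverse selfbij_one selfbij_inv selfbij_mul.
Proof. by move=> f; apply: selfbij_ext => x /=; rewrite sb_funK. Qed.
Lemma selfbij_mulV : right_inverse selfbij_one selfbij_inv selfbij_mul.
Proof. by move=> f; apply: selfbij_ext => x /=; rewrite sb_invK. Qed.

HB.instance Definition _ := isGroup.Build (selfbij T)
  selfbij_mulA selfbij_1mul selfbij_mul1 selfbij_Vmul selfbij_mulV.

End SelfBijGroup.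

(* The letter (x, false) stands for x and (x, true) for its inverse. *)
Definition word (X : Type) := seq (X * bool).
Definition lpos (X : Type) (x : X) : X * bool := (x, false).
Definition linv (X : Type) (x : X) : X * bool := (x, true).

(* Equality in the group < X | rel >, whose elements are the words modulo
   this congruence. *)
Inductive pres_eq (X : Type) (rel : word X -> word X -> Prop) :
    word X -> word X -> Prop :=
| pres_refl u : pres_eq rel u u
| pres_sym u v : pres_eq rel u v -> pres_eq rel v u
| pres_trans u v w : pres_eq rel u v -> pres_eq rel v w -> pres_eq rel u w
| pres_cat u u' v v' :
    pres_eq rel u u' -> pres_eq rel v v' -> pres_eq rel (u ++ v) (u' ++ v')
| pres_cancel x b : pres_eq rel [:: (x, b); (x, ~~ b)] [::]
| pres_rel u v : rel u v -> pres_eq rel u v.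

Definition word_eval (G : groupType) (X : Type) (gen : X -> G) (w : word X) : G :=
  foldr (fun l g => ((if l.2 then (gen l.1)^-1 else gen l.1) * g)%g) 1%g w.

(* gen induces an isomorphism from < X | rel > onto the subgroup H of G. *)
Definition has_presentation (G : groupType) (H : set G) (X : Type)
    (gen : X -> G) (rel : word X -> word X -> Prop) : Prop :=
  range (word_eval gen) = H /\
  forall u v, word_eval gen u = word_eval gen v <-> pres_eq rel u v.

Definition tau (R : realType) : R := (Num.sqrt 5 - 1) / 2.

Definition Ztau (R : realType) : set R :=
  [set z | exists p : {poly int}, z = (map_poly intr p).[tau R]].

Definition Ioc01 (R : realType) := set_type (`]0, 1]%classic : set R).

Definition left_continuous (R : realType) (f : Ioc01 R -> Ioc01 R) : Prop :=
  forall t : Ioc01 R,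
    f @ within [set s : Ioc01 R | val s < val t] (nbhs t) --> f t.

(* The finite set b contains all breakpoints: f is affine, with slope a power
   of tau, on every open interval that avoids b. *)
Definition pl_tau (R : realType) (f : Ioc01 R -> Ioc01 R) : Prop :=
  exists2 b : seq R, (forall z, z \in b -> Ztau z) &
    forall u v : R, 0 <= u -> u < v -> v <= 1 ->
      (forall z, z \in b -> ~ (u < z < v)) ->
      exists (k : int) (c : R), forall t : Ioc01 R,
        u < val t < v -> val (f t) = tau R ^ k * val t + c.

Definition Vtau (R : realType) : set (selfbij (Ioc01 R)) :=
  [set g | left_continuous g /\ pl_tau g].

Section Circle.
Variable R : realType.

Definition Icc01 := set_type (`[0, 1]%classic : set R).

Definition circle_end (s : Icc01) : bool := (val s == 0) || (val s == 1).

Let crel (s t : Icc01) : bool := (s == t) || (circle_end s && circle_end t).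

Lemma circle_rel_refl : reflexive crel.
Proof. by move=> s; rewrite /crel eqxx. Qed.
Lemma circle_rel_sym : symmetric crel.
Proof. by move=> s t; rewrite /crel eq_sym andbC. Qed.
Lemma circle_rel_trans : transitive crel.
Proof.
move=> t s u /predU1P[-> //|/andP[hs ht]] /predU1P[<-|/andP[_ hu]].
  by rewrite /crel hs ht orbT.
by rewrite /crel hs hu orbT.
Qed.

Definition circle_rel :=
  EquivRel crel circle_rel_refl circle_rel_sym circle_rel_trans.
Definition circle := {eq_quot circle_rel}.
HB.instance Definition _ := Topological.copy circle (quotient_topology circle).
HB.instance Definition _ := Quotient.on circle.

Lemma frac_subproof (t : R) :
  t - (Num.floor t)%:~R \in (`[0, 1]%classic : set R).
Proof.
apply/mem_set => /=; rewrite in_itv /= subr_ge0 floor_le /=.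
by rewrite lerBlDl; apply/ltW; have := floorD1_gt t; rewrite intrD.
Qed.

Definition frac01 (t : R) : Icc01 :=
  exist (fun z => z \in (`[0, 1]%classic : set R)) _ (frac_subproof t).

(* The covering map of the circle by the line, t |-> class of t modulo 1. *)
Definition circle_cover (t : R) : circle := \pi_circle (frac01 t).

Lemma circle_coverE (s : Icc01) : circle_cover (val s) = \pi_circle s.
Proof.
have /set_mem /= := valP s; rewrite in_itv /= => /andP[s0 s1].
have [s1'|e] : val s < 1 \/ val s = 1.
  by move: s1; rewrite le_eqVlt => /orP[/eqP|]; auto.
- congr (\pi _); apply: val_inj => /=.
  by rewrite (floor_def (m := 0)) ?subr0 // s0.
- apply/eqmodP; apply/orP; right.
  by rewrite /circle_end /= e floor1 subrr !eqxx orbT.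
Qed.

Definition homeomorphism (h : circle -> circle) : Prop :=
  continuous h /\
  exists h', [/\ cancel h h', cancel h' h & continuous h'].

(* h lifts to an increasing map of the universal cover of the circle. *)
Definition orientation_preserving (h : circle -> circle) : Prop :=
  exists F : R -> R,
    [/\ continuous F, {homo F : s t / s < t} &
        forall t, circle_cover (F t) = h (circle_cover t)].

End Circle.

Definition Ttau (R : realType) : set (selfbij (Ioc01 R)) :=
  [set g | Vtau g /\
    exists h : circle R -> circle R,
      [/\ homeomorphism h, orientation_preserving h &
          forall t : Ioc01 R,
            h (circle_cover (val t)) = circle_cover (val (g t))]].

Inductive caret := Xcaret | Ycaret.
Inductive tree := Leaf | Node of caret & tree & tree.

Fixpoint nleaves (T : tree) : nat :=
  if T is Node _ l r then (nleaves l + nleaves r)%N else 1%N.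

(* T with a caret of type c attached to its leaf number i *)
Fixpoint attach (c : caret) (i : nat) (T : tree) : tree :=
  match T with
  | Leaf => if i == 0%N then Node c Leaf Leaf else Leaf
  | Node d l r =>
      if (i < nleaves l)%N then Node d (attach c i l) r
      else Node d l (attach c (i - nleaves l) r)
  end.

Fixpoint spine (m : nat) : tree :=
  if m is m'.+1 then Node Xcaret Leaf (spine m') else Leaf.

Lemma nleaves_spine m : nleaves (spine m) = m.+1.
Proof. by elim: m => //= m ->. Qed.

Lemma nleaves_attach c i T :
  (i < nleaves T)%N -> nleaves (attach c i T) = (nleaves T).+1.
Proof.
elim: T i => [|d l IHl r IHr] i /=; first by rewrite ltnS leqn0 => ->.
move=> lti; case: (ltnP i (nleaves l)) => hi /=; first by rewrite IHl.
by rewrite IHr ?addnS // ltn_subLR.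
Qed.

Record ktree (k : nat) := KTree { ktree_val :> tree; ktreeP : nleaves ktree_val = k }.

Section TreePairs.
Variable R : realType.

Lemma tau_gt0 : 0 < tau R.
Proof.
rewrite /tau divr_gt0 // subr_gt0 -[ltLHS]sqrtr1 ltr_sqrt ?ltr0n //.
by rewrite ltr1n.
Qed.

Lemma tau_lt1 : tau R < 1.
Proof.
rewrite /tau ltr_pdivrMr ?ltr0n // mul1r ltrBlDr.
have -> : 2 + 1 = Num.sqrt (3 ^+ 2) :> R by rewrite sqrtr_sqr ger0_norm ?ler0n //; lra.
by rewrite ltr_sqrt ?exprn_gt0 ?ltr0n // -natrX ltr_nat.
Qed.

Definition caret_ratio (c : caret) : R :=
  match c with Xcaret => tau R ^+ 2 | Ycaret => tau R end.

Lemma caret_ratio_gt0 c : 0 < caret_ratio c.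
Proof. by case: c; rewrite /= ?exprn_gt0 // tau_gt0. Qed.

Lemma caret_ratio_lt1 c : caret_ratio c < 1.
Proof.
by case: c; rewrite /= ?tau_lt1 // exprn_ilt1 ?tau_lt1 // ltW // tau_gt0.
Qed.

(* The subdivision of the interval (a, b] given by T; the pair (u, v) encodes
   the interval (u, v]. *)
Fixpoint leaves (T : tree) (a b : R) : seq (R * R) :=
  if T is Node c l r then
    let m := a + caret_ratio c * (b - a) in leaves l a m ++ leaves r m b
  else [:: (a, b)].

Lemma size_leaves T a b : size (leaves T a b) = nleaves T.
Proof. by elim: T a b => //= c l IHl r IHr a b; rewrite size_cat IHl IHr. Qed.

Lemma caret_split c (a b : R) : a < b ->
  a < a + caret_ratio c * (b - a) < b.
Proof.
move=> ab; have := caret_ratio_gt0 c; have := caret_ratio_lt1 c => h1 h0.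
have d0 : 0 < b - a by rewrite subr_gt0.
rewrite ltrDl mulr_gt0 //= -ltrBrDl.
by rewrite -[ltRHS]mul1r ltr_pM2r.
Qed.

Definition in_oc (x : R) (J : R * R) := J.1 < x <= J.2.

Lemma leaves_itv T (a b : R) : a < b ->
  all (fun J => [&& a <= J.1, J.1 < J.2 & J.2 <= b]) (leaves T a b).
Proof.
elim: T a b => [|c l IHl r IHr] a b ab /=; first by rewrite !lexx ab.
have /andP[am mb] := caret_split c ab; rewrite all_cat; apply/andP; split.
- apply: sub_all (IHl _ _ am) => J /and3P[-> -> /le_trans] /=.
  by apply; apply: ltW.
- apply: sub_all (IHr _ _ mb) => J /and3P[h -> ->] /=; rewrite !andbT.
  by apply: le_trans h; apply: ltW.
Qed.

Lemma leaves_cover T (a b x : R) : a < b -> a < x <= b ->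
  has (in_oc x) (leaves T a b).
Proof.
elim: T a b => [|c l IHl r IHr] a b ab /=; first by rewrite orbF.
have /andP[am mb] := caret_split c ab => /andP[ax xb]; rewrite has_cat.
case: (leP x (a + caret_ratio c * (b - a))) => hx; apply/orP.
- by left; apply: IHl => //; rewrite ax.
- by right; apply: IHr => //; rewrite hx.
Qed.

Lemma leaves_disjoint T (a b : R) : a < b ->
  pairwise (fun J K => J.2 <= K.1) (leaves T a b).
Proof.
elim: T a b => [|c l IHl r IHr] a b ab //=.
have /andP[am mb] := caret_split c ab.
rewrite pairwise_cat IHl // IHr // !andbT.
apply/allrelP => J K JL KR.
have /allP/(_ J JL)/and3P[_ _ h1] := leaves_itv l am.
have /allP/(_ K KR)/and3P[h2 _ _] := leaves_itv r mb.
exact: le_trans h1 h2.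
Qed.

Definition leaf_itv k (T : ktree k) (i : 'I_k) : R * R :=
  nth (0, 0) (leaves T 0 1) i.

Lemma leaf_index_subproof k (T : ktree k) (x : Ioc01 R) :
  (find (in_oc (val x)) (leaves T 0 1) < k)%N.
Proof.
rewrite -[X in (_ < X)%N](ktreeP T) -(size_leaves T 0 1) -has_find.
by apply: leaves_cover => //; have /set_mem /= := valP x; rewrite in_itv.
Qed.

Definition leaf_index k (T : ktree k) (x : Ioc01 R) : 'I_k :=
  Ordinal (leaf_index_subproof T x).

Lemma leaf_itvP k (T : ktree k) i :
  [&& 0 <= (leaf_itv T i).1, (leaf_itv T i).1 < (leaf_itv T i).2
    & (leaf_itv T i).2 <= 1].
Proof.
have /allP := leaves_itv T (@ltr01 R); apply.
by rewrite mem_nth // size_leaves ktreeP.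
Qed.

Lemma leaf_indexP k (T : ktree k) (x : Ioc01 R) :
  in_oc (val x) (leaf_itv T (leaf_index T x)).
Proof.
apply: nth_find; apply: leaves_cover => //.
by have /set_mem /= := valP x; rewrite in_itv.
Qed.

Lemma leaf_index_uniq k (T : ktree k) (x : Ioc01 R) i :
  in_oc (val x) (leaf_itv T i) -> leaf_index T x = i.
Proof.
have /andP[h1 h2] := leaf_indexP T x => /andP[h3 h4].
have /(pairwiseP (0, 0)) D := leaves_disjoint T (@ltr01 R).
have sz (j : 'I_k) : (val j \in gtn (size (leaves T 0 1))).
  by rewrite inE size_leaves ktreeP; exact: ltn_ord.
apply: val_inj; case: (ltngtP (leaf_index T x) i) => // lt.
- have := D _ _ (sz _) (sz _) lt => le.
  by have := lt_le_trans h3 (le_trans h2 le); rewrite ltxx.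
- have := D _ _ (sz _) (sz _) lt => le.
  by have := lt_le_trans h1 (le_trans h4 le); rewrite ltxx.
Qed.

(* the increasing affine map of (J.1, J.2] onto (K.1, K.2] *)
Definition affine_onto (J K : R * R) (x : R) : R :=
  K.1 + (x - J.1) / (J.2 - J.1) * (K.2 - K.1).

Lemma affine_onto_in (J K : R * R) x : J.1 < J.2 -> K.1 < K.2 ->
  in_oc x J -> in_oc (affine_onto J K x) K.
Proof.
move=> hJ hK /andP[h1 h2]; rewrite /in_oc /affine_onto.
have dJ : 0 < J.2 - J.1 by rewrite subr_gt0.
have dK : 0 < K.2 - K.1 by rewrite subr_gt0.
rewrite ltrDl mulr_gt0 ?divr_gt0 ?subr_gt0 //= -lerBrDl.
by rewrite -[leRHS]mul1r ler_pM2r // ler_pdivrMr // mul1r lerB.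
Qed.

Lemma affine_ontoK (J K : R * R) x : J.1 < J.2 -> K.1 < K.2 ->
  affine_onto K J (affine_onto J K x) = x.
Proof.
move=> hJ hK; rewrite /affine_onto (addrC K.1) addrK.
have dJ : J.2 - J.1 != 0 by rewrite subr_eq0 gt_eqF.
have dK : K.2 - K.1 != 0 by rewrite subr_eq0 gt_eqF.
by rewrite mulfK // divfK // addrC subrK.
Qed.

Section Triple.
Variables (k : nat) (T1 : ktree k) (s : 'S_k) (T2 : ktree k).

Definition triple_val (x : Ioc01 R) : R :=
  affine_onto (leaf_itv T2 (leaf_index T2 x))
              (leaf_itv T1 (s (leaf_index T2 x))) (val x).

Lemma triple_val_in x : in_oc (triple_val x) (leaf_itv T1 (s (leaf_index T2 x))).
Proof.
apply: affine_onto_in (leaf_indexP _ _).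
- by case/and3P: (leaf_itvP T2 (leaf_index T2 x)).
- by case/and3P: (leaf_itvP T1 (s (leaf_index T2 x))).
Qed.

Lemma triple_subproof x : triple_val x \in (`]0, 1]%classic : set R).
Proof.
apply/mem_set; rewrite /= in_itv /=.
have /and3P[h0 _ h1] := leaf_itvP T1 (s (leaf_index T2 x)).
have /andP[h2 h3] := triple_val_in x.
by rewrite (le_lt_trans h0 h2) (le_trans h3 h1).
Qed.

(* leaf i of T2 is mapped onto leaf s i of T1 *)
Definition triple_fun (x : Ioc01 R) : Ioc01 R :=
  exist (fun z => z \in (`]0, 1]%classic : set R)) _ (triple_subproof x).

End Triple.

Lemma triple_funK k (T1 : ktree k) (s s' : 'S_k) (T2 : ktree k) : cancel s s' ->
  cancel (triple_fun T1 s T2) (triple_fun T2 s' T1).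
Proof.
move=> sK x; apply: val_inj => /=; rewrite {1}/triple_val.
rewrite (leaf_index_uniq (i := s (leaf_index T2 x))) ?triple_val_in // sK /=.
apply: affine_ontoK.
- by case/and3P: (leaf_itvP T2 (leaf_index T2 x)).
- by case/and3P: (leaf_itvP T1 (s (leaf_index T2 x))).
Qed.

Definition triple k (T1 : ktree k) (s : 'S_k) (T2 : ktree k) :
    selfbij (Ioc01 R) :=
  SelfBij (triple_funK T1 T2 (permK s)) (triple_funK T2 T1 (permKV s)).

End TreePairs.

Definition kspine m : ktree m.+1 := KTree (nleaves_spine m).

Lemma nleaves_attach_spine c n : nleaves (attach c n (spine n.+1)) = n.+3.
Proof. by rewrite nleaves_attach nleaves_spine. Qed.

Definition kattach c n : ktree n.+3 := KTree (nleaves_attach_spine c n).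

(* ord_pred sends 0 to n.+1 and i > 0 to i.-1 *)
Definition gamma n : 'S_n.+2 := perm (@ord_pred_inj n.+2).

Definition xelt (R : realType) n : selfbij (Ioc01 R) :=
  triple R (kattach Xcaret n) 1%g (kspine n.+2).
Definition yelt (R : realType) n : selfbij (Ioc01 R) :=
  triple R (kattach Ycaret n) 1%g (kspine n.+2).
Definition celt (R : realType) n : selfbij (Ioc01 R) :=
  triple R (kspine n.+1) (gamma n) (kspine n.+1).

Inductive Tgen : Type :=
| gx of nat
| gy of nat
| gc (n : nat) of (0 < n)%N.

Definition Tgen_elt (R : realType) (g : Tgen) : selfbij (Ioc01 R) :=
  match g with
  | gx n => xelt R n
  | gy n => yelt R n
  | gc n _ => celt R n
  end.

Local Notation x_ n := (lpos (gx n)).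
Local Notation y_ n := (lpos (gy n)).
Local Notation y_inv n := (linv (gy n)).
Local Notation c_ hn := (lpos (gc hn)).
(* c_{n+1}, whose index is automatically positive *)
Local Notation c_S n := (lpos (@gc n.+1 isT)).

Inductive Trel : word Tgen -> word Tgen -> Prop :=
| rel_xx i j : (i < j)%N -> Trel [:: x_ j; x_ i] [:: x_ i; x_ j.+1]
| rel_xy i j : (i < j)%N -> Trel [:: x_ j; y_ i] [:: y_ i; x_ j.+1]
| rel_yx i j : (i < j)%N -> Trel [:: y_ j; x_ i] [:: x_ i; y_ j.+1]
| rel_yy i j : (i < j)%N -> Trel [:: y_ j; y_ i] [:: y_ i; y_ j.+1]
| rel_y2 n : Trel [:: y_ n; y_ n] [:: x_ n; x_ n.+1]
| rel_xc k n (hn : (0 < n)%N) : (k < n)%N ->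
    Trel [:: x_ k; c_S n] [:: c_ hn; x_ k.+1]
| rel_cx0 n (hn : (0 < n)%N) : Trel [:: c_ hn; x_ 0] [:: c_S n; c_S n]
| rel_c n (hn : (0 < n)%N) : Trel [:: c_ hn] [:: x_ n; c_S n]
| rel_cX n (hn : (0 < n)%N) : Trel (nseq n.+2 (c_ hn)) [::]
| rel_yc k n (hn : (0 < n)%N) : (k < n)%N ->
    Trel [:: y_ k; c_S n] [:: c_ hn; y_ k.+1]
| rel_cy0 n (hn : (0 < n)%N) :
    Trel [:: c_ hn; y_ 0] [:: y_inv n.+1; c_S n; c_S n].

(* Main.v *)
Require Import Defs.
From HB Require Import structures.
From mathcomp Require Import all_boot all_order all_algebra all_fingroup.
From mathcomp Require Import all_classical all_reals all_analysis.
From mathcomp Require Import zify ring lra.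
Set Implicit Arguments.
Unset Strict Implicit.
Unset Printing Implicit Defensive.
Import Order.TTheory GRing.Theory Num.Theory.
Import numFieldNormedType.Exports.
Local Open Scope ring_scope.

(** The elements (T1, pi, T2) with pi a rotation of the leaf positions are
    compared with the expressions p c ^ k q ^-1 in an arbitrary group G with
    elements x_n, y_n, c_n that satisfy the relations.

    Generation. An element f of T_tau cuts (0, 1] at one point and exchanges the
    two parts, increasingly on each; f jumps there, so this point is a break
    point or 1. An interval with end points in Z[tau] is a union of intervals
    whose lengths are powers of tau (Ztau_levels), so f maps a sequence of such
    intervals, up to a rotation, onto another one. Only the exponents of the
    lengths matter: a caret replaces an exponent n by n + 2, n + 1 or by n + 1,
    n + 2, and any two sequences of exponents with the same total length have a
    common refinement (slen_eq_joinable). Refining first the domain and then the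
    image, both become the leaves of trees (Ttau_represents). Conversely, such a
    rotation lifts to an increasing bijection of the line and so turns the
    circle (turning_circle, represents_Ttau).

    Relations. In G a tree T has an element, the product of one generator for
    each of its carets (tree_elt). It depends only on the subdivision
    (tree_elt_exps): a tree with a leaf boundary at the point where a caret
    divides the root interval can be given that caret as its root by means of
    y_n y_n = x_n x_{n+1} alone (tree_elt_reroot). The relations with c_n say
    that cutting a leaf of the domain cuts the leaf onto which c_n maps it
    (rgen_cstep). Together with common refinements this brings every word to the
    form tree_elt T1 * c ^ k * (tree_elt T2) ^-1, with trees and k that do not
    depend on G (nf_word). In T_tau this expression is the element given by
    T1, T2 and the rotation by k (represents_nf); if it is the identity, then
    k = 0 and T1, T2 have the same leaves (represents_id), whence the expression
    is trivial in every G, in particular in the presented group. *)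

(** * Cutting the entries of a sequence *)

Section CutAt.
Variables (A : Type) (cut : caret -> A -> A * A).

Fixpoint cut_at (c : caret) (i : nat) (s : seq A) {struct s} : seq A :=
  match s, i with
  | [::], _ => [::]
  | a :: s', 0 => [:: (cut c a).1, (cut c a).2 & s']
  | a :: s', i'.+1 => a :: cut_at c i' s'
  end.

Definition cuts (o : seq (caret * nat)) (s : seq A) : seq A :=
  foldl (fun s p => cut_at p.1 p.2 s) s o.

Lemma cuts_cat o p s : cuts (o ++ p) s = cuts p (cuts o s).
Proof. exact: foldl_cat. Qed.

Lemma cut_at_cat c i s t : cut_at c i (s ++ t) =
  if (i < size s)%N then cut_at c i s ++ t else s ++ cut_at c (i - size s) t.
Proof.
elim: s i => [|a s IH] [|i] //=; rewrite ?subn0 //.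
by rewrite IH ltnS subSS; case: ifP.
Qed.

Lemma cut_at_out c i s : (size s <= i)%N -> cut_at c i s = s.
Proof. by elim: s i => [|a s IH] [|i] //= h; rewrite IH. Qed.

Lemma size_cut_at c i s : (i < size s)%N -> size (cut_at c i s) = (size s).+1.
Proof. by elim: s i => [|a s IH] [|i] //= h; rewrite IH. Qed.

Definition shift_op (p : caret * nat) := (p.1, p.2.+1).

Lemma cuts_cons o a s : cuts (map shift_op o) (a :: s) = a :: cuts o s.
Proof. by elim: o s => //= p o IH s; rewrite IH. Qed.

Lemma cut_atC c d i j s : (i < j)%N ->
  cut_at d i (cut_at c j s) = cut_at c j.+1 (cut_at d i s).
Proof. by elim: s i j => [|a s IH] [|i] [|j] //= h; rewrite IH. Qed.

End CutAt.

Lemma map_cut_at A B (cA : caret -> A -> A * A) (cB : caret -> B -> B * B)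
    (f : A -> B) c i s :
  (forall c a, cB c (f a) = (f (cA c a).1, f (cA c a).2)) ->
  map f (cut_at cA c i s) = cut_at cB c i (map f s).
Proof. by move=> H; elim: s i => [|a s IH] [|i] //=; rewrite ?H ?IH. Qed.

Lemma map_cuts A B (cA : caret -> A -> A * A) (cB : caret -> B -> B * B)
    (f : A -> B) o s :
  (forall c a, cB c (f a) = (f (cA c a).1, f (cA c a).2)) ->
  map f (cuts cA o s) = cuts cB o (map f s).
Proof. by move=> H; elim: o s => //= p o IH s; rewrite IH (map_cut_at _ _ _ H). Qed.

(** An interval of length tau ^ n is recorded by its exponent n. *)
Definition cutn (c : caret) (n : nat) : nat * nat :=
  match c with Xcaret => (n.+2, n.+1) | Ycaret => (n.+1, n.+2) end.


Local Notation ncut := (cut_at cutn).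
Local Notation ncuts := (cuts cutn).

Lemma cutn_diamond p q (s : seq nat) :
  exists p' q', [/\ (size p' <= 1)%N, (size q' <= 1)%N &
    ncuts p' (ncut p.1 p.2 s) = ncuts q' (ncut q.1 q.2 s)].
Proof.
case: p q => [c i] [d j] /=.
elim: s i j => [|a s IH] [|i] [|j] //=; try by exists [::], [::].
- clear IH; case: c d => [] []; try by exists [::], [::].
  + by exists [:: (Xcaret, 1%N)], [:: (Ycaret, 0%N)].
  + by exists [:: (Ycaret, 0%N)], [:: (Xcaret, 1%N)].
- by exists [:: (d, j.+2)], [:: (c, 0%N)].
- by exists [:: (d, 0%N)], [:: (c, i.+2)].
have [p' [q' [hp hq e]]] := IH i j.
by exists (map shift_op p'), (map shift_op q'); rewrite !size_map !cuts_cons e.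
Qed.

Lemma cutn_strip p o (s : seq nat) : (size p <= 1)%N ->
  exists p' o', (size p' <= 1)%N /\
    ncuts p' (ncuts o s) = ncuts o' (ncuts p s).
Proof.
elim: o p s => [|q o IH] p s hp; first by exists p, [::].
case: p hp => [|r [|? ?]] // _; first by exists [::], (q :: o).
have [q' [r' [hq' hr' e]]] := cutn_diamond r q s.
have [p' [ o' [hp' e']]] := IH r' (ncut q.1 q.2 s) hr'.
by exists p', (q' ++ o'); split => //=; rewrite e' cuts_cat e.
Qed.

(** Two different cuts of the same entry n have the common refinement
    n + 2, n + 3, n + 2; as one further cut on either side is enough there, the
    diamond property passes to arbitrary sequences of cuts. *)
Lemma cutn_confluent o p (s : seq nat) :
  exists o' p', ncuts o' (ncuts o s) = ncuts p' (ncuts p s).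
Proof.
elim: o p s => [|q o IH] p s; first by exists p, [::].
have [q' [p' [_ e]]] := @cutn_strip [:: q] p s isT.
have [ o1 [p1 e1]] := IH p' (ncut q.1 q.2 s).
by exists o1, (q' ++ p1); rewrite cuts_cat e -e1.
Qed.

Definition joinable (s t : seq nat) := exists o p, ncuts o s = ncuts p t.

Lemma joinable_refl s : joinable s s. Proof. by exists [::], [::]. Qed.

Lemma joinable_sym s t : joinable s t -> joinable t s.
Proof. by case=> o [p e]; exists p, o. Qed.

Lemma joinable_trans t s u : joinable s t -> joinable t u -> joinable s u.
Proof.
move=> [ o [p e]] [q [r e']]; have [p' [q' h]] := cutn_confluent p q t.
by exists (o ++ p'), (r ++ q'); rewrite !cuts_cat e h e'.
Qed.

Lemma joinable_cons a s t : joinable s t -> joinable (a :: s) (a :: t).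
Proof.
by move=> [ o [p e]]; exists (map shift_op o), (map shift_op p); rewrite !cuts_cons e.
Qed.

Lemma joinable_swap n s : joinable [:: n, n.+1 & s] [:: n.+1, n & s].
Proof. by exists [:: (Ycaret, 0%N)], [:: (Xcaret, 1%N)]. Qed.

Definition level N a b := nseq a N ++ nseq b N.+1.

Lemma joinable_bubble N a b : joinable (N.+1 :: level N a b) (level N a b.+1).
Proof.
elim: a => [|a IH] /=; first exact: joinable_refl.
apply: joinable_trans (joinable_cons N IH).
exact/joinable_sym/joinable_swap.
Qed.

Lemma joinable_level_cons N n a b : (n <= N.+1)%N ->
  exists a' b', joinable (n :: level N a b) (level N a' b').
Proof.
move: {2}(N.+1 - n)%N (leqnn (N.+1 - n)%N) => m.
elim: m n a b => [|m IH] n a b hm hn.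
  exists a, b.+1; have -> : n = N.+1 by lia.
  exact: joinable_bubble.
have [hlt|hge] := ltnP n N; last first.
  have [->|->] : n = N \/ n = N.+1 by lia.
    by exists a.+1, b; exact: joinable_refl.
  by exists a, b.+1; exact: joinable_bubble.
have [a1 [b1 h1]] : exists a' b', joinable (n.+2 :: level N a b) (level N a' b').
  by apply: IH; lia.
have [a2 [b2 h2]] : exists a' b', joinable (n.+1 :: level N a1 b1) (level N a' b').
  by apply: IH; lia.
exists a2, b2; apply: joinable_trans h2.
apply: joinable_trans (joinable_cons _ h1).
by exists [:: (Ycaret, 0%N)], [::].
Qed.

(** The entries are cut down to N and N + 1 one after the other; as adjacent
    entries N and N + 1 may be exchanged up to refinement, their order does not
    matter. *)
Lemma joinable_level N s : all (leq^~ N) s ->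
  exists a b, joinable s (level N a b).
Proof.
elim: s => [_|n s IH /= /andP[hn /IH [a [b h]]]].
  by exists 0%N, 0%N; exact: joinable_refl.
have [a' [b' h']] := @joinable_level_cons N n a b (leqW hn).
by exists a', b'; apply: joinable_trans h'; exact: joinable_cons.
Qed.

(** * The golden ratio *)

Section Golden.
Variable R : realType.
Local Notation tau := (tau R).

Lemma tau_sqr : tau ^+ 2 = 1 - tau.
Proof.
have h : Num.sqrt 5 ^+ 2 = 5 :> R by rewrite sqr_sqrtr // ler0n.
rewrite /Defs.tau expr_div_n sqrrB h.
by field.
Qed.

Lemma tauX n : tau ^+ n.+1 + tau ^+ n.+2 = tau ^+ n.
Proof. by rewrite -addn2 exprD tau_sqr exprS; ring. Qed.

Lemma tauX_gt0 n : 0 < tau ^+ n.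
Proof. by rewrite exprn_gt0 // tau_gt0. Qed.

Lemma tauX_lt m n : (tau ^+ m < tau ^+ n) = (n < m)%N.
Proof. by apply: ltr_iXn2l; [exact: tau_gt0|exact: tau_lt1]. Qed.

Lemma fib_square_eq0 (p q : nat) : (p * p + p * q = q * q)%N -> q = 0%N.
Proof.
elim/ltn_ind: q p => q IH p e; case: (posnP q) => // q0.
have pq : (p < q)%N by nia.
have p0 : p = 0%N.
  have [r er] : exists r, q = (p + r)%N by exists (q - p)%N; lia.
  by apply: (IH p pq r); rewrite er in e; nia.
by rewrite p0 in e; nia.
Qed.

(** Irrationality of tau, by descent: a solution p = tau q in naturals gives
    the smaller solution q - p = tau p. *)
Lemma tau_irrational (a b a' b' : nat) :
  a%:R + b%:R * tau = a'%:R + b'%:R * tau -> a = a' /\ b = b'.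
Proof.
wlog : a b a' b' / (b <= b')%N.
  move=> H e; case: (leqP b b') => h; first exact: H.
  by have [] := H a' b' a b (ltnW h) (esym e).
move=> hb e.
have t0 := tau_gt0 R.
have e1 : a%:R - a'%:R = (b' - b)%:R * tau by rewrite natrB //; lra.
have ha : (a' <= a)%N.
  by rewrite -(ler_nat R) -subr_ge0 e1 mulr_ge0 // ?ler0n // ltW.
rewrite -natrB // in e1.
have e2 : ((a - a') * (a - a') + (a - a') * (b' - b) = (b' - b) * (b' - b))%N.
  apply/eqP; rewrite -(eqr_nat R) natrD !natrM e1.
  set x : R := _%:R.
  apply/eqP; transitivity (x ^+ 2 * (tau ^+ 2 + tau)); first by ring.
  by rewrite tau_sqr; ring.
have h0 := fib_square_eq0 e2.
rewrite h0 muln0 addn0 in e2.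
by split; nia.
Qed.

Definition slen (s : seq nat) : R := \sum_(n <- s) tau ^+ n.

Lemma slen_nil : slen [::] = 0. Proof. exact: big_nil. Qed.
Lemma slen_cons n s : slen (n :: s) = tau ^+ n + slen s.
Proof. exact: big_cons. Qed.
Lemma slen_cat s t : slen (s ++ t) = slen s + slen t.
Proof. exact: big_cat. Qed.
Lemma slen_ge0 s : 0 <= slen s.
Proof. by apply: sumr_ge0 => n _; exact/ltW/tauX_gt0. Qed.
Lemma slen_gt0 n s : 0 < slen (n :: s).
Proof. by rewrite slen_cons ltr_pwDl ?tauX_gt0 ?slen_ge0. Qed.

Lemma slen_nseq a n : slen (nseq a n) = a%:R * tau ^+ n.
Proof.
by elim: a => [|a IH]; rewrite ?slen_nil ?mul0r //= slen_cons IH -nat1r mulrDl mul1r.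
Qed.

Lemma slen_cut_at c i s : slen (ncut c i s) = slen s.
Proof.
elim: s i => [|n s IH] [|i] //=; last by rewrite !slen_cons IH.
by case: c {IH}; rewrite /= !slen_cons -(tauX n); ring.
Qed.

Lemma slen_cuts o s : slen (ncuts o s) = slen s.
Proof. by elim: o s => //= p o IH s; rewrite IH slen_cut_at. Qed.

Lemma slen_joinable s t : joinable s t -> slen s = slen t.
Proof. by case=> o [p e]; rewrite -(slen_cuts o) e slen_cuts. Qed.

Lemma slen_level N a b : slen (level N a b) = (a%:R + b%:R * tau) * tau ^+ N.
Proof. by rewrite slen_cat !slen_nseq exprS; ring. Qed.

(** Both sequences can be cut down to entries N and N + 1 only, and the
    irrationality of tau fixes the two multiplicities. *)
Lemma slen_eq_joinable s t : slen s = slen t -> joinable s t.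
Proof.
move=> e; pose N := foldr maxn 0%N (s ++ t).
have hN : all (leq^~ N) (s ++ t).
  rewrite /N; elim: (s ++ t) => //= n u IH; rewrite leq_maxl /=.
  by apply: sub_all IH => m /= h; rewrite (leq_trans h) // leq_maxr.
move: hN; rewrite all_cat => /andP[].
move=> /joinable_level[a [b h]] /joinable_level[a' [b' h']].
have : slen (level N a b) = slen (level N a' b').
  by rewrite -(slen_joinable h) e (slen_joinable h').
rewrite !slen_level => /(mulIf (lt0r_neq0 (tauX_gt0 N))) /tau_irrational[ea eb].
by apply: joinable_trans h _; rewrite ea eb; exact: joinable_sym.
Qed.

Lemma slen_prefix_lt s1 s2 t1 t2 : s1 ++ s2 = t1 ++ t2 -> slen s1 < slen t1 ->
  exists u, t1 = s1 ++ u /\ s2 = u ++ t2.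
Proof.
elim: s1 t1 => [|n s1 IH] [|m t1] //=.
- by rewrite ltxx.
- by move=> -> _; exists (m :: t1).
- by rewrite slen_nil ltNge slen_ge0.
- move=> [-> e]; rewrite !slen_cons ltrD2l => /(IH _ e) [u [-> ->]].
  by exists u.
Qed.

Lemma slen_prefix_eq s1 s2 t1 t2 : s1 ++ s2 = t1 ++ t2 -> slen s1 = slen t1 ->
  s1 = t1 /\ s2 = t2.
Proof.
elim: s1 t1 => [|n s1 IH] [|m t1] //=.
- by rewrite slen_nil => _ h; have := slen_gt0 m t1; rewrite -h ltxx.
- by rewrite slen_nil => _ h; have := slen_gt0 n s1; rewrite h ltxx.
- by move=> [-> e]; rewrite !slen_cons => /addrI /(IH _ e) [-> ->].
Qed.

End Golden.

(** * Trees and their leaf exponents *)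

Fixpoint exps (n : nat) (T : tree) : seq nat :=
  if T is Node c l r then exps (cutn c n).1 l ++ exps (cutn c n).2 r else [:: n].

Lemma size_exps n T : size (exps n T) = nleaves T.
Proof. by elim: T n => //= c l IHl r IHr n; rewrite size_cat IHl IHr. Qed.

Lemma nleaves_gt0 T : (0 < nleaves T)%N.
Proof. by elim: T => //= c l IHl r IHr; rewrite addn_gt0 IHl. Qed.

Lemma exps_attach n c i T : exps n (attach c i T) = ncut c i (exps n T).
Proof.
elim: T n i => [|d l IHl r IHr] n i /=; first by case: i => [|i] //; case: c.
by rewrite cut_at_cat size_exps; case: ifP => _ /=; rewrite ?IHl ?IHr.
Qed.

Definition attachs (o : seq (caret * nat)) (T : tree) : tree :=
  foldl (fun T p => attach p.1 p.2 T) T o.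

Lemma exps_attachs n o T : exps n (attachs o T) = ncuts o (exps n T).
Proof. by elim: o T => //= p o IH T; rewrite IH exps_attach. Qed.

Lemma slen_exps (R : realType) n T : slen R (exps n T) = tau R ^+ n.
Proof.
elim: T n => [|c l IHl r IHr] n /=; first by rewrite slen_cons slen_nil addr0.
by rewrite slen_cat IHl IHr; case: c; rewrite //= ?tauX // addrC tauX.
Qed.

Lemma attach_spine m : attach Xcaret m (spine m) = spine m.+1.
Proof. by elim: m => //= m IH; rewrite subSS subn0 IH. Qed.

(** * Groups satisfying the relations *)

Definition Trel_model (G : groupType) (gen : Tgen -> G) : Prop :=
  forall u v, Trel u v -> word_eval gen u = word_eval gen v.

Section Model.
Variables (G : groupType) (gen : Tgen -> G).
Local Open Scope group_scope.
Implicit Types (c d : caret) (T : tree).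

Definition cgen c n : G := gen (match c with Xcaret => gx n | Ycaret => gy n end).
(** This is c_{m+1}, which rotates m + 3 leaves. *)
Definition rgen m : G := gen (@gc m.+1 isT).

(** The element by which the element of a tree is multiplied when a caret is
    attached to leaf q; the flag tells whether this is the last leaf, where an
    x-caret only lengthens the spine. *)
Definition cstep c q (last : bool) : G :=
  if last then (if c is Ycaret then (cgen Ycaret q)^-1 else 1) else cgen c q.
Arguments cstep : simpl never.

(** The element of T read from its carets, when T is grafted on leaf m of a
    spine whose last leaf is m (if the flag is set) or beyond m. The right
    subtree is attached before the left one, whose leaves would shift its
    position. *)
Fixpoint tree_elt T m (last : bool) : G :=
  if T is Node c l r then
    cstep c m last * tree_elt r m.+1 last * tree_elt l m false
  else 1.

Lemma tree_elt_spine n m : tree_elt (spine n) m true = 1.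
Proof. by elim: n m => //= n IH m; rewrite IH !mulg1. Qed.

Hypothesis M : Trel_model gen.

Lemma cgenC c d i j : (i < j)%N -> cgen d j * cgen c i = cgen c i * cgen d j.+1.
Proof.
move=> ij.
have := M (rel_xx ij); have := M (rel_xy ij); have := M (rel_yx ij); have := M (rel_yy ij).
by rewrite /= !mulg1; case: c d => [] [].
Qed.

Lemma cgen_yy n :
  cgen Ycaret n * cgen Ycaret n = cgen Xcaret n * cgen Xcaret n.+1.
Proof. by have /= := M (rel_y2 n); rewrite !mulg1. Qed.

Lemma cstepC c d i j b : (i < j)%N -> cstep d j b * cgen c i = cgen c i * cstep d j.+1 b.
Proof.
move=> ij; rewrite /cstep; case: b; last exact: cgenC.
case: d; first by rewrite mul1g mulg1.
by apply: (mulgI (cgen Ycaret j)); rewrite mulgA mulgV mul1g mulgA cgenC // mulgK.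
Qed.

Lemma cstep_tree c T m q b : (m < q)%N ->
  cstep c q b * tree_elt T m false =
  tree_elt T m false * cstep c (q + (nleaves T).-1) b.
Proof.
elim: T m q => [|d l IHl r IHr] m q mq /=; first by rewrite mul1g mulg1 addn0.
rewrite -[cstep d m false]/(cgen d m) -!mulgA (mulgA (cstep _ _ _)) cstepC // -!mulgA.
congr (_ * _); rewrite (mulgA (cstep _ _ _)) IHr // -!mulgA.
congr (_ * _); rewrite IHl; last by lia.
congr (_ * cstep _ _ _); have := nleaves_gt0 l; have := nleaves_gt0 r; lia.
Qed.

Lemma tree_elt_attach c i T m b : (i < nleaves T)%N ->
  tree_elt (attach c i T) m b =
  tree_elt T m b * cstep c (m + i) (b && (i.+1 == nleaves T)).
Proof.
elim: T m i b => [|d l IHl r IHr] m i b /=.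
  by rewrite ltnS leqn0 => /eqP -> /=; rewrite !mulg1 mul1g addn0 eqxx andbT.
have l0 := nleaves_gt0 l; have r0 := nleaves_gt0 r => hi.
case: ltnP => hl /=.
  rewrite IHl //= mulgA; congr (_ * cstep _ _ _).
  have -> : (i.+1 == nleaves l + nleaves r)%N = false by lia.
  by rewrite andbF.
rewrite IHr; last by lia.
have -> : ((i - nleaves l).+1 == nleaves r) = (i.+1 == nleaves l + nleaves r)%N by lia.
rewrite -!mulgA cstep_tree; last by lia.
by do 3!congr (_ * _); congr cstep; lia.
Qed.

Lemma tree_elt_cgen c T m k b : (m < k)%N ->
  tree_elt T k b * cgen c m = cgen c m * tree_elt T k.+1 b.
Proof.
elim: T k b => [|d l IHl r IHr] k b hk /=; first by rewrite mul1g mulg1.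
rewrite -!mulgA IHl // (mulgA (tree_elt r _ _)) IHr; last by lia.
by rewrite !mulgA cstepC.
Qed.

(** The relation y_n y_n = x_n x_{n+1}: an x-caret with an x-caret on its right
    leg and a y-caret with a y-caret on its left leg subdivide alike. *)
Lemma tree_elt_rotate l r1 r2 m b :
  tree_elt (Node Xcaret l (Node Xcaret r1 r2)) m b =
  tree_elt (Node Ycaret (Node Ycaret l r1) r2) m b.
Proof.
have sh : tree_elt r2 m.+1 b * cgen Ycaret m = cgen Ycaret m * tree_elt r2 m.+2 b.
  exact: tree_elt_cgen.
rewrite /= !mulgA; do 2!congr (_ * _).
rewrite -[cstep Ycaret m false]/(cgen Ycaret m) -(mulgA _ (tree_elt _ _ _)) sh mulgA; congr (_ * _).
by case: b {sh}; rewrite /cstep ?mulVg ?mulg1 // cgen_yy.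
Qed.

Lemma rgen_cx k m : (k <= m)%N -> cgen Xcaret k * rgen m.+1 = rgen m * cgen Xcaret k.+1.
Proof. by move=> km; have /= := M (@rel_xc k m.+1 isT km); rewrite !mulg1. Qed.

Lemma rgen_cy k m : (k <= m)%N -> cgen Ycaret k * rgen m.+1 = rgen m * cgen Ycaret k.+1.
Proof. by move=> km; have /= := M (@rel_yc k m.+1 isT km); rewrite !mulg1. Qed.

Lemma rgen_cc c k m : (k <= m)%N -> cgen c k * rgen m.+1 = rgen m * cgen c k.+1.
Proof. by case: c => km; [exact: rgen_cx | exact: rgen_cy]. Qed.

Lemma rgen_x m : rgen m = cgen Xcaret m.+1 * rgen m.+1.
Proof. by have /= := M (@rel_c m.+1 isT); rewrite !mulg1. Qed.

Lemma rgen_x0 m : rgen m * cgen Xcaret 0 = rgen m.+1 ^+ 2.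
Proof. by have /= := M (@rel_cx0 m.+1 isT); rewrite !mulg1. Qed.

Lemma rgen_y0 m : rgen m * cgen Ycaret 0 = (cgen Ycaret m.+2)^-1 * rgen m.+1 ^+ 2.
Proof. by have /= := M (@rel_cy0 m.+1 isT); rewrite !mulg1. Qed.

Lemma rgenX m : rgen m ^+ m.+3 = 1.
Proof.
have := M (@rel_cX m.+1 isT); rewrite [RHS]/= => <-.
by elim: m.+3 => //= n <-; rewrite expgS.
Qed.

Lemma rgenX_cgen c k m j : (k + j <= m.+1)%N ->
  rgen m ^+ j * cgen c (k + j) = cgen c k * rgen m.+1 ^+ j.
Proof.
elim: j => [|j IH] h; first by rewrite !expg0 mul1g mulg1 addn0.
rewrite expgSr -mulgA addnS -rgen_cc; last by lia.
by rewrite mulgA IH ?expgSr ?mulgA //; lia.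
Qed.

(** The analogue for y-carets of c_n = x_n c_{n+1}: carry y_n around a full turn
    c_n ^ (n + 2) = 1. *)
Lemma rgen_y m : rgen m * (cgen Ycaret m.+2)^-1 = cgen Ycaret m.+1 * rgen m.+1.
Proof.
have e : rgen m ^+ m.+2 * cgen Ycaret m.+1 = (cgen Ycaret m.+2)^-1 * (rgen m.+1)^-1.
  rewrite expgS -mulgA (@rgenX_cgen _ 0 m m.+1) // mulgA rgen_y0 -mulgA -expgD.
  by congr (_ * _); apply: (mulIg (rgen m.+1)); rewrite -expgSr mulVg -(rgenX m.+1).
have e1 : rgen m ^+ m.+2 = (rgen m)^-1.
  by apply: (mulIg (rgen m)); rewrite -expgSr rgenX mulVg.
apply: (mulgI (rgen m)^-1); rewrite mulKg mulgA -e1 e -mulgA mulVg mulg1 //.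
Qed.

Definition rot1 m i := if i is i'.+1 then i' else m.+2.

Lemma rgen_cstep c m i : (i < m.+3)%N ->
  rgen m * cstep c i (i == m.+2) =
  cstep c (rot1 m i) (rot1 m i == m.+2) * rgen m.+1 ^+ (i == 0%N).+1.
Proof.
case: i => [|i] hi /=.
  rewrite eqxx /cstep /=; case: c; last exact: rgen_y0.
  by rewrite mul1g rgen_x0.
rewrite eqSS /cstep; have [->|ne] := eqVneq i m.+1.
  have -> : (m.+1 == m.+2)%N = false by lia.
  by rewrite expg1; case: c; rewrite ?mulg1 ?rgen_y // rgen_x.
have -> : (i == m.+2)%N = false by lia.
by rewrite expg1 rgen_cc //; lia.
Qed.

Lemma rgenX_modn m k : rgen m ^+ k = rgen m ^+ (k %% m.+3).
Proof. by rewrite {1}(divn_eq k m.+3) expgD mulnC expgM rgenX expg1n mul1g. Qed.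

End Model.

(** If leaf i is cut, c ^ k becomes this power: whenever the cut leaf passes
    through position 0, both of its halves have to be carried to the end. *)
Fixpoint turns m k i := if k is k'.+1 then
  (turns m k' i + (iter k' (rot1 m) i == 0%N).+1)%N else 0%N.

Lemma rot1_lt m i : (i < m.+3)%N -> (rot1 m i < m.+3)%N.
Proof. by case: i => //= i h; rewrite ltnW. Qed.

Lemma iter_rot1_lt m k i : (i < m.+3)%N -> (iter k (rot1 m) i < m.+3)%N.
Proof. by elim: k => //= k IH h; rewrite rot1_lt ?IH. Qed.

Lemma rgenX_cstep (G : groupType) (gen : Tgen -> G) c m k i :
    Trel_model gen -> (i < m.+3)%N ->
  (rgen gen m ^+ k * cstep gen c i (i == m.+2) =
  cstep gen c (iter k (rot1 m) i) (iter k (rot1 m) i == m.+2) *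
    rgen gen m.+1 ^+ turns m k i)%g.
Proof.
move=> M hi; elim: k => [|k IH] /=; first by rewrite mul1g mulg1.
rewrite expgS -mulgA IH mulgA rgen_cstep ?iter_rot1_lt // -mulgA -expgD.
by rewrite addnC.
Qed.

(** * Trees with the same leaves *)

Section SameLeaves.
Variables (R : realType) (G : groupType) (gen : Tgen -> G).
Hypothesis M : Trel_model gen.
Local Notation tau := (tau R).

(** A tree having a leaf boundary at the dividing point of a caret c may be
    given the root c. If its root is the other caret, that point divides one of
    the two subtrees in the ratio of this other caret, so that induction exposes
    the two carets of one side of y_n y_n = x_n x_{n+1}. *)
Lemma tree_elt_reroot c n T s1 s2 :
  exps n T = s1 ++ s2 -> slen R s1 = tau ^+ (cutn c n).1 ->
  exists l r, exps n (Node c l r) = exps n T /\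
    forall m b, tree_elt gen T m b = tree_elt gen (Node c l r) m b.
Proof.
elim: T c n s1 s2 => [|d l IHl r IHr] c n s1 s2.
  case: s1 => [|a s1].
    by move=> _; rewrite slen_nil => h; have := tauX_gt0 R (cutn c n).1; rewrite -h ltxx.
  case: s1 => // -[<- _]; rewrite slen_cons slen_nil addr0 => /eqP.
  by rewrite eq_le !leNgt !tauX_lt; case: c => /=; lia.
case: c d => [] [] e h; try by exists l, r.
- have lt : slen R s1 < slen R (exps (cutn Ycaret n).1 l).
    by rewrite h slen_exps tauX_lt /=; lia.
  have [u [el eu]] := slen_prefix_lt (esym e) lt.
  have [l1 [l2 [e1 h1]]] := IHl Ycaret _ _ _ el h.
  exists l1, (Node Xcaret l2 r); split.
    by rewrite /= -[in RHS]e1 /= -catA.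
  by move=> m b; rewrite tree_elt_rotate //= h1.
have lt : slen R (exps (cutn Xcaret n).1 l) < slen R s1.
  by rewrite h slen_exps tauX_lt /=; lia.
have [u [el eu]] := slen_prefix_lt e lt.
have hu : slen R u = tau ^+ n.+3.
  have : slen R (exps n.+2 l) + slen R u = tau ^+ n.+1 by rewrite -slen_cat -el h.
  by rewrite slen_exps -(tauX R n.+1); lra.
have [r1 [r2 [e1 h1]]] := IHr Xcaret _ _ _ eu hu.
exists (Node Ycaret l r1), r2; split.
  by rewrite /= -[in RHS]e1 /= -catA.
by move=> m b; rewrite -tree_elt_rotate //= h1.
Qed.

(** Once the second tree is given the root caret of the first, the respective
    subtrees have the same leaves. *)
Lemma tree_elt_exps T T' n m b : exps n T = exps n T' ->
  tree_elt gen T m b = tree_elt gen T' m b.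
Proof.
elim: T T' n m b => [|c l IHl r IHr] T' n m b e.
  case: T' e => //= d l r /(congr1 size); rewrite size_cat !size_exps /=.
  by have := nleaves_gt0 l; have := nleaves_gt0 r; lia.
have [l' [r' [e1 h1]]] := tree_elt_reroot (esym e) (slen_exps R _ l).
have [el er] : exps (cutn c n).1 l' = exps (cutn c n).1 l /\
               exps (cutn c n).2 r' = exps (cutn c n).2 r.
  by apply: (@slen_prefix_eq R); [exact: etrans e1 (esym e) | rewrite !slen_exps].
by rewrite h1 /= (IHl l' (cutn c n).1) // (IHr r' (cutn c n).2).
Qed.

End SameLeaves.

(** * Normal forms *)

Section NormalForm.
Local Open Scope group_scope.

Definition nf (G : groupType) (gen : Tgen -> G) m T1 k T2 : G :=
  tree_elt gen T1 0 true * rgen gen m ^+ k * (tree_elt gen T2 0 true)^-1.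

(** Equalities of normal forms are stated for all groups satisfying the
    relations at once, so that they hold simultaneously in the presented group
    and in the group of transformations. *)
Definition nf_eq m T1 k T2 m' T1' k' T2' := forall (G : groupType) (gen : Tgen -> G),
  Trel_model gen -> nf gen m T1 k T2 = nf gen m' T1' k' T2'.

Lemma nf_attach c i m T1 k T2 :
    nleaves T1 = m.+3 -> nleaves T2 = m.+3 -> (i < m.+3)%N ->
  exists T1' k', nleaves T1' = m.+4 /\ nf_eq m T1 k T2 m.+1 T1' k' (attach c i T2).
Proof.
move=> h1 h2 hi; have hj := @iter_rot1_lt m k i hi.
exists (attach c (iter k (rot1 m) i) T1), (turns m k i); split.
  by rewrite nleaves_attach h1.
move=> G gen M; rewrite /nf !(tree_elt_attach M) ?h1 ?h2 // !add0n !eqSS.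
rewrite invMg -!mulgA; congr (_ * _); rewrite !mulgA -rgenX_cstep //.
by rewrite mulgK.
Qed.

Lemma attach_out c i T : (nleaves T <= i)%N -> attach c i T = T.
Proof.
elim: T i => [|d l IHl r IHr] [|i] //= hi; first by have := nleaves_gt0 l; lia.
have -> : (i.+1 < nleaves l)%N = false by have := nleaves_gt0 r; lia.
by rewrite IHr //; lia.
Qed.

Lemma nf_attachs o m T1 k T2 : nleaves T1 = m.+3 -> nleaves T2 = m.+3 ->
  exists m' T1' k', [/\ nleaves T1' = m'.+3, nleaves (attachs o T2) = m'.+3
    & nf_eq m T1 k T2 m' T1' k' (attachs o T2)].
Proof.
elim: o m T1 k T2 => [|[c i] o IH] m T1 k T2 h1 h2; first by exists m, T1, k.
have [hi|hi] := ltnP i m.+3; last first.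
  have [m' [T1' [k' H]]] := IH m T1 k T2 h1 h2.
  by exists m', T1', k'; rewrite /= attach_out ?h2.
have [T1' [k' [e1 e2]]] := nf_attach c k h1 h2 hi.
have h2' : nleaves (attach c i T2) = m.+4 by rewrite nleaves_attach h2.
have [m' [T1'' [k'' [ea eb ec]]]] := IH _ _ k' _ e1 h2'.
by exists m', T1'', k''; split => //= G gen M; rewrite e2 // ec.
Qed.

Lemma rgenXV (G : groupType) (gen : Tgen -> G) m k : Trel_model gen ->
  (rgen gen m ^+ k)^-1 = rgen gen m ^+ (k * m.+2).
Proof.
move=> M; apply: (mulgI (rgen gen m ^+ k)); rewrite mulgV -expgD.
have -> : (k + k * m.+2 = m.+3 * k)%N by lia.
by rewrite expgM rgenX // expg1n.
Qed.

Lemma nfV (G : groupType) (gen : Tgen -> G) m T1 k T2 : Trel_model gen ->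
  (nf gen m T1 k T2)^-1 = nf gen m T2 (k * m.+2) T1.
Proof. by move=> M; rewrite /nf !invMg invgK rgenXV // mulgA. Qed.

(** Common refinements exist, so that two normal forms can be expanded until
    the inner trees cancel. *)
Lemma nf_mul (R : realType) m1 T1 a T2 m2 T3 b T4 :
    nleaves T1 = m1.+3 -> nleaves T2 = m1.+3 ->
    nleaves T3 = m2.+3 -> nleaves T4 = m2.+3 ->
  exists m T k T', [/\ nleaves T = m.+3, nleaves T' = m.+3 &
    forall (G : groupType) (gen : Tgen -> G), Trel_model gen ->
      nf gen m1 T1 a T2 * nf gen m2 T3 b T4 = nf gen m T k T'].
Proof.
move=> h1 h2 h3 h4.
have [ o [p e]] : joinable (exps 0 T2) (exps 0 T3).
  by apply: (@slen_eq_joinable R); rewrite !slen_exps.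
rewrite -!exps_attachs in e.
have [m [T [k [e1 e2 e3]]]] := nf_attachs o a h1 h2.
(* Normal forms are expanded at their right tree, so the second factor is
   inverted. *)
have [m' [T' [k' [e1' e2' e3']]]] := nf_attachs p (b * m2.+2) h4 h3.
have em : m = m'.
  by move: (congr1 size e); rewrite !size_exps e2 e2' => -[].
subst m'; exists m, T, (k + k' * m.+2)%N, T'; split => // G gen M.
rewrite e3 // -[nf gen m2 _ _ _]invgK nfV // e3' // nfV //.
by rewrite /nf (tree_elt_exps R M 0 true e) -!mulgA mulKg expgD !mulgA.
Qed.

Lemma nf_word (R : realType) w :
  exists m T1 k T2, [/\ nleaves T1 = m.+3, nleaves T2 = m.+3 &
    forall (G : groupType) (gen : Tgen -> G), Trel_model gen ->
      word_eval gen w = nf gen m T1 k T2].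
Proof.
elim: w => [|[x b] w [m2 [T3 [k2 [T4 [h3 h4 IH]]]]]].
  exists 0%N, (spine 2), 0%N, (spine 2); split => // G gen M.
  by rewrite /nf tree_elt_spine expg0 !mul1g invg1.
have [m1 [T1 [k1 [T2 [h1 h2 hx]]]]] : exists m T1 k T2,
    [/\ nleaves T1 = m.+3, nleaves T2 = m.+3 &
    forall (G : groupType) (gen : Tgen -> G), Trel_model gen ->
      gen x = nf gen m T1 k T2].
  have hg c n (G : groupType) (gen : Tgen -> G) (M : Trel_model gen) :
      cgen gen c n = nf gen n (attach c n (spine n.+1)) 0 (spine n.+2).
    rewrite /nf (tree_elt_attach M) ?nleaves_spine // !(tree_elt_spine gen).
    by rewrite eqSS ltn_eqF // expg0 invg1 mul1g !mulg1 add0n.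
  case: x => [n|n|[//|n] hn].
  - exists n, (attach Xcaret n (spine n.+1)), 0%N, (spine n.+2).
    by split; [exact: nleaves_attach_spine | exact: nleaves_spine | exact: (hg Xcaret)].
  - exists n, (attach Ycaret n (spine n.+1)), 0%N, (spine n.+2).
    by split; [exact: nleaves_attach_spine | exact: nleaves_spine | exact: (hg Ycaret)].
  exists n, (spine n.+2), 1%N, (spine n.+2); rewrite !nleaves_spine; split => // G gen M.
  rewrite /nf !(tree_elt_spine gen) invg1 mulg1 mul1g expg1.
  by congr (gen (gc _)); exact: bool_irrelevance.
have [m [T [k [T' [h h' hm]]]]] : exists m T k T', [/\ nleaves T = m.+3, nleaves T' = m.+3 &
    forall (G : groupType) (gen : Tgen -> G), Trel_model gen ->
      (if b then (gen x)^-1 else gen x) * nf gen m2 T3 k2 T4 = nf gen m T k T'].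
  case: b; last first.
    have [m [T [k [T' [h h' hm]]]]] := nf_mul R k1 k2 h1 h2 h3 h4.
    by exists m, T, k, T'; split => // G gen M; rewrite hx // hm.
  have [m [T [k [T' [h h' hm]]]]] := nf_mul R (k1 * m1.+2) k2 h2 h1 h3 h4.
  by exists m, T, k, T'; split => // G gen M; rewrite hx // nfV // hm.
exists m, T, k, T'; split => // G gen M.
by rewrite /= -/(word_eval gen w) IH // hm.
Qed.

End NormalForm.

(** * Rotations of subdivisions *)

(** An entry (d, r) stands for an interval of length tau ^ d that is mapped
    affinely onto an interval of length tau ^ r. *)
Definition cutp c (p : nat * nat) : (nat * nat) * (nat * nat) :=
  (((cutn c p.1).1, (cutn c p.2).1), ((cutn c p.1).2, (cutn c p.2).2)).

Local Notation pcut := (cut_at cutp).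
Local Notation pcuts := (cuts cutp).

Section Pieces.
Variable R : realType.
Local Notation tau := (tau R).
Local Notation slen := (slen R).
Implicit Types (f g : selfbij (Ioc01 R)).

Fixpoint part (a : R) (s : seq nat) : seq (R * R) :=
  if s is n :: s' then (a, a + tau ^+ n) :: part (a + tau ^+ n) s' else [::].

Lemma size_part a s : size (part a s) = size s.
Proof. by elim: s a => //= n s IH a; rewrite IH. Qed.

Lemma part_cat a s t : part a (s ++ t) = part a s ++ part (a + slen s) t.
Proof.
elim: s a => [|n s IH] a /=; first by rewrite slen_nil addr0.
by rewrite IH slen_cons addrA.
Qed.

Lemma tauX_cutn c n : tau ^+ (cutn c n).1 + tau ^+ (cutn c n).2 = tau ^+ n.
Proof. by case: c; rewrite /= ?tauX // addrC tauX. Qed.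

Lemma leaves_part T a n : leaves T a (a + tau ^+ n) = part a (exps n T).
Proof.
elim: T a n => //= c l IHl r IHr a n; rewrite part_cat slen_exps -IHl -IHr.
set m := a + _; have -> : m = a + tau ^+ (cutn c n).1.
  by rewrite /m addrAC subrr add0r; case: c {m} => /=; rewrite !exprS; ring.
by congr (_ ++ leaves r _ _); rewrite -addrA tauX_cutn.
Qed.

Lemma map_fst_cut c i s : map fst (pcut c i s) = ncut c i (map fst s).
Proof. by apply: map_cut_at => -[] [d r]. Qed.

Lemma map_snd_cut c i s : map snd (pcut c i s) = ncut c i (map snd s).
Proof. by apply: map_cut_at => -[] [d r]. Qed.

Definition dom_len (s : seq (nat * nat)) := slen (map fst s).
Definition img_len (s : seq (nat * nat)) := slen (map snd s).

Fixpoint pieces (u v : R) (s : seq (nat * nat)) : seq ((R * R) * (R * R)) :=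
  if s is p :: s' then
    ((u, u + tau ^+ p.1), (v, v + tau ^+ p.2)) ::
    pieces (u + tau ^+ p.1) (v + tau ^+ p.2) s'
  else [::].

Lemma piecesE u v s : pieces u v s = zip (part u (map fst s)) (part v (map snd s)).
Proof. by elim: s u v => //= p s IH u v; rewrite IH. Qed.

Lemma pieces_cat u v s t :
  pieces u v (s ++ t) = pieces u v s ++ pieces (u + dom_len s) (v + img_len s) t.
Proof.
elim: s u v => [|p s IH] u v /=; first by rewrite /dom_len /img_len slen_nil !addr0.
by rewrite IH /dom_len /img_len /= !slen_cons !addrA.
Qed.

Lemma pieces_bound u v s p : p \in pieces u v s -> u <= p.1.1 /\ p.1.2 <= u + dom_len s.
Proof.
elim: s u v => //= q s IH u v; have t0 := tauX_gt0 R q.1.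
rewrite /dom_len /= slen_cons addrA inE => /predU1P[->|/IH [h1 h2]] /=.
  by rewrite lexx lerDl slen_ge0.
by rewrite h2 (le_trans _ h1) // lerDl ltW.
Qed.

Lemma pieces_cover u v s x : u < x <= u + dom_len s ->
  exists2 p, p \in pieces u v s & in_oc x p.1.
Proof.
elim: s u v => [|p s IH] u v /=.
  by rewrite /dom_len slen_nil addr0 => /andP[h /(lt_le_trans h)]; rewrite ltxx.
rewrite /dom_len slen_cons addrA => /andP[h1 h2].
have [h|h] := leP x (u + tau ^+ p.1).
  by eexists; first exact: mem_head; rewrite /in_oc /= h1.
have [|q hq hx] := IH (u + tau ^+ p.1) (v + tau ^+ p.2); first by rewrite h.
by exists q => //; rewrite inE hq orbT.
Qed.

Definition agree f (P : seq ((R * R) * (R * R))) := forall p, p \in P ->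
  forall x, in_oc (val x) p.1 -> val (f x) = affine_onto p.1 p.2 (val x).

Lemma agree_cons f p P : agree f (p :: P) <->
  (forall x, in_oc (val x) p.1 -> val (f x) = affine_onto p.1 p.2 (val x)) /\ agree f P.
Proof.
split=> [H|[h H] q].
  by split=> [|q hq]; apply: H; rewrite inE ?eqxx // hq orbT.
by rewrite inE => /predU1P[->|/H].
Qed.

Lemma agree_cat f P Q : agree f (P ++ Q) <-> agree f P /\ agree f Q.
Proof.
split=> [H|[h H] q]; last by rewrite mem_cat => /orP[/h|/H].
by split=> q hq; apply: H; rewrite mem_cat hq ?orbT.
Qed.

Lemma affine_onto_len (u v a b x : R) :
  affine_onto (u, u + a) (v, v + b) x = v + (x - u) / a * b.
Proof. by rewrite /affine_onto /= ![_ + _ - _]addrAC !subrr !add0r. Qed.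

Lemma cutn_ratio c d r :
  tau ^+ (cutn c d).1 / tau ^+ d = tau ^+ (cutn c r).1 / tau ^+ r /\
  tau ^+ (cutn c d).2 / tau ^+ d = tau ^+ (cutn c r).2 / tau ^+ r.
Proof.
have td n : tau ^+ n != 0 by rewrite gt_eqF // tauX_gt0.
by split; apply/eqP; rewrite eqr_div // -!exprD; apply/eqP; congr (_ ^+ _);
  case: c => /=; lia.
Qed.

(** An affine map respects the ratios at which a caret divides. *)
Lemma agree_cut f c i u v s : agree f (pieces u v s) -> agree f (pieces u v (pcut c i s)).
Proof.
elim: s i u v => //= -[d r] s IH [|i] u v /= /agree_cons[/= h H]; last first.
  by apply/agree_cons; split => //; exact: IH.
have td n : tau ^+ n != 0 by rewrite gt_eqF // tauX_gt0.
have e n := tauX_cutn c n.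
have [q q'] := cutn_ratio c d r.
apply/agree_cons; split=> [x /andP[/= h1 h2]|].
  rewrite h; last first.
    by rewrite /in_oc /= h1 (le_trans h2) // lerD2l -(e d) lerDl ltW // tauX_gt0.
  rewrite !affine_onto_len; congr (_ + _).
  have -> : tau ^+ (cutn c r).1 = tau ^+ (cutn c d).1 / tau ^+ d * tau ^+ r.
    by rewrite q divfK.
  by field; rewrite !td.
apply/agree_cons; split=> [x /andP[/= h1 h2]|]; last by rewrite -!addrA !e.
rewrite h; last first.
  rewrite /in_oc /= (lt_trans _ h1) ?ltrDl ?tauX_gt0 //.
  by move: h2; rewrite -addrA e.
rewrite !affine_onto_len -addrA; congr (_ + _).
have -> : tau ^+ (cutn c r).2 = tau ^+ (cutn c d).2 / tau ^+ d * tau ^+ r.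
  by rewrite q' divfK.
have -> : tau ^+ (cutn c r).1 = tau ^+ (cutn c d).1 / tau ^+ d * tau ^+ r.
  by rewrite q divfK.
by field; rewrite !td.
Qed.

(** The images of s1 come last in (0, 1], behind those of s2; hence the
    offsets. *)
Definition rotates f s1 s2 :=
  agree f (pieces 0 (img_len s2) s1 ++ pieces (dom_len s1) 0 s2).

Lemma rotates_cutl f c i s1 s2 : rotates f s1 s2 -> rotates f (pcut c i s1) s2.
Proof.
case/agree_cat => h1 h2; apply/agree_cat; split; first exact: agree_cut.
by rewrite /dom_len map_fst_cut slen_cut_at.
Qed.

Lemma rotates_cutr f c i s1 s2 : rotates f s1 s2 -> rotates f s1 (pcut c i s2).
Proof.
case/agree_cat => h1 h2; apply/agree_cat; split; last exact: agree_cut.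
by rewrite /img_len map_snd_cut slen_cut_at.
Qed.

Lemma rotates_uniq f g s1 s2 : dom_len (s1 ++ s2) = 1 ->
  rotates f s1 s2 -> rotates g s1 s2 -> f = g.
Proof.
rewrite /dom_len map_cat slen_cat => e H1 H2; apply: selfbij_ext => x.
have /set_mem /= := valP x; rewrite in_itv /= => /andP[x0 x1].
apply: val_inj; have [h|h] := leP (val x) (dom_len s1).
  have [|p hp hx] := @pieces_cover 0 (img_len s2) s1 (val x).
    by rewrite x0 add0r.
  by rewrite (H1 p) ?(H2 p) // mem_cat hp.
have [|p hp hx] := @pieces_cover (dom_len s1) 0 s2 (val x).
  by rewrite h e.
by rewrite (H1 p) ?(H2 p) // mem_cat hp orbT.
Qed.

(** The triple (T1, pi, T2) for pi the rotation by k, in a form without proofs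
    about numbers of leaves, in which cutting a leaf is a local operation. *)
Definition represents f T1 k T2 := exists s1 s2,
  [/\ size s1 = k, map fst (s1 ++ s2) = exps 0 T2, map snd (s2 ++ s1) = exps 0 T1
    & rotates f s1 s2].

Lemma represents_exps f T1 k T2 T1' T2' : exps 0 T1 = exps 0 T1' ->
  exps 0 T2 = exps 0 T2' -> represents f T1 k T2 -> represents f T1' k T2'.
Proof. by move=> e1 e2 [s1 [s2 []]]; rewrite e1 e2; exists s1, s2. Qed.

Lemma represents_leaves f T1 k T2 : represents f T1 k T2 ->
  nleaves T1 = nleaves T2 /\ (k <= nleaves T2)%N.
Proof.
move=> [s1 [s2 [hk /(congr1 size) h1 /(congr1 size) h2 _]]].
move: h1 h2; rewrite !size_map !size_exps !size_cat hk => <- <-.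
by rewrite addnC leq_addr.
Qed.

Lemma represents_uniq f g T1 k T2 :
  represents f T1 k T2 -> represents g T1 k T2 -> f = g.
Proof.
move=> [s1 [s2 [hk h1 h2 H]]] [s1' [s2' [hk' h1' h2' H']]].
have hs : size s1 = size s1' by rewrite hk.
have hs2 : size s2 = size s2'.
  move: (congr1 size h1) (congr1 size h1').
  by rewrite !size_map !size_cat => <- /eqP; rewrite -hs eqn_add2l => /eqP.
have /eqP := etrans h1 (esym h1'); have /eqP := etrans h2 (esym h2').
rewrite !map_cat !eqseq_cat ?size_map //.
move=> /andP[/eqP a1 /eqP a2] /andP[/eqP a3 /eqP a4].
have zip_inj (s t : seq (nat * nat)) : map fst s = map fst t -> map snd s = map snd t -> s = t.
  by elim: s t => [|[a b] s IH] [|[a' b'] t] //= [-> e] [-> e']; rewrite (IH t).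
rewrite (zip_inj s1 s1') // in h1 H *; rewrite (zip_inj s2 s2') // in h1 H *.
apply: rotates_uniq H H'; rewrite /dom_len h1.
by rewrite slen_exps.
Qed.

Definition cut_leaf n k i := if (i < k)%N then (n - k + i)%N else (i - k)%N.

Lemma represents_attach f T1 k T2 c i : represents f T1 k T2 -> (i < nleaves T2)%N ->
  represents f (attach c (cut_leaf (nleaves T1) k i) T1) (k + (i < k)) (attach c i T2).
Proof.
move=> H hi; have [en hk] := represents_leaves H.
case: H => s1 [s2 [h0 h1 h2 H]].
have hs2 : (nleaves T1 - k)%N = size s2.
  by rewrite -(size_exps 0) -h2 size_map size_cat h0 addnK.
rewrite /cut_leaf; case: ltnP => hik.
  exists (pcut c i s1), s2; split; last exact: rotates_cutl.
  - by rewrite size_cut_at h0 // addn1.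
  - by rewrite exps_attach -h1 !map_cat map_fst_cut cut_at_cat size_map h0 hik.
  - rewrite exps_attach -h2 !map_cat map_snd_cut cut_at_cat size_map hs2.
    by rewrite ltnNge leq_addr addKn.
exists s1, (pcut c (i - k) s2); split; last exact: rotates_cutr.
- by rewrite addn0.
- by rewrite exps_attach -h1 !map_cat map_fst_cut cut_at_cat size_map h0 ltnNge hik.
- rewrite exps_attach -h2 !map_cat map_snd_cut cut_at_cat size_map -hs2.
  by have -> : (i - k < nleaves T1 - k)%N by lia.
Qed.

(** ** Rotations and triples *)

Definition rotation n k : 'S_n := (perm (@ord_pred_inj n) ^+ k)%g.

Lemma rotationE n k (i : 'I_n) : (k <= n)%N ->
  rotation n k i = (if (i < k)%N then n - k + i else i - k)%N :> nat.
Proof.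
elim: k => [|k IH] hk; first by rewrite /rotation expg0 perm1 !subn0.
rewrite /rotation expgSr permM permE /= -/(rotation n k) IH ?(ltnW hk) //.
have hi := ltn_ord i; case: (ltngtP i k) => h.
- have -> : (i < k.+1)%N by lia.
  have -> : ((n - k + i + n).-1 = (n - k.+1 + i) + n)%N by lia.
  by rewrite modnDr modn_small //; lia.
- have -> : (i < k.+1)%N = false by lia.
  have -> : ((i - k + n).-1 = (i - k.+1) + n)%N by lia.
  by rewrite modnDr modn_small //; lia.
- by rewrite h ltnSn subnn add0n modn_small; lia.
Qed.

Lemma rotation_full n : rotation n n = 1%g.
Proof.
apply/permP => i; rewrite perm1; apply: val_inj; rewrite /= rotationE //.
by rewrite ltn_ord subnn.
Qed.

Lemma rotation_mod n k : rotation n k = rotation n (k %% n).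
Proof.
rewrite {1}/rotation {1}(divn_eq k n) expgD mulnC expgM -/(rotation n n) rotation_full.
by rewrite expg1n mul1g.
Qed.

Lemma leaf_itv_part n (T : ktree n) i : leaf_itv R T i = nth (0, 0) (part 0 (exps 0 T)) i.
Proof. by rewrite /leaf_itv -leaves_part expr0 add0r. Qed.

Lemma triple_leaf n (T1 : ktree n) p (T2 : ktree n) i x :
  in_oc (val x) (leaf_itv R T2 i) ->
  val (triple R T1 p T2 x) = affine_onto (leaf_itv R T2 i) (leaf_itv R T1 (p i)) (val x).
Proof. by move=> h; rewrite /= /triple_val (leaf_index_uniq h). Qed.

Lemma agree_nth f u v s :
  (forall i, (i < size s)%N -> forall x,
     in_oc (val x) (nth (0, 0) (part u (map fst s)) i) ->
     val (f x) = affine_onto (nth (0, 0) (part u (map fst s)) i)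
                             (nth (0, 0) (part v (map snd s)) i) (val x)) ->
  agree f (pieces u v s).
Proof.
move=> H p /(nthP ((0, 0), (0, 0))) [i]; rewrite piecesE => hi <- x.
rewrite nth_zip ?size_part ?size_map //= => hx; apply: H => //.
by move: hi; rewrite size_zip !size_part !size_map minnn.
Qed.

Lemma represents_triple n (T1 T2 : ktree n) k : (k <= n)%N ->
  represents (triple R T1 (rotation n k) T2) T1 k T2.
Proof.
move=> hk; set e1 := exps 0 T1; set e2 := exps 0 T2.
have z1 : size e1 = n by rewrite size_exps (ktreeP T1).
have z2 : size e2 = n by rewrite size_exps (ktreeP T2).
set s1 := zip (take k e2) (drop (n - k) e1).
set s2 := zip (drop k e2) (take (n - k) e1).
have t2 : size (take k e2) = k by rewrite size_takel // z2.
have d1 : size (drop (n - k) e1) = k by rewrite size_drop z1 subKn.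
have d2 : size (drop k e2) = (n - k)%N by rewrite size_drop z2.
have t1 : size (take (n - k) e1) = (n - k)%N by rewrite size_takel // z1 leq_subr.
have f1 : map fst s1 = take k e2 by apply: unzip1_zip; rewrite t2 d1.
have f2 : map fst s2 = drop k e2 by apply: unzip1_zip; rewrite d2 t1.
have g1 : map snd s1 = drop (n - k) e1 by apply: unzip2_zip; rewrite t2 d1.
have g2 : map snd s2 = take (n - k) e1 by apply: unzip2_zip; rewrite d2 t1.
have y1 : size s1 = k by rewrite size_zip t2 d1 minnn.
have y2 : size s2 = (n - k)%N by rewrite size_zip d2 t1 minnn.
have c2 : map fst s1 ++ map fst s2 = e2 by rewrite f1 f2 cat_take_drop.
have c1 : map snd s2 ++ map snd s1 = e1 by rewrite g1 g2 cat_take_drop.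
exists s1, s2; split; rewrite ?map_cat //; apply/agree_cat; split; apply: agree_nth => i.
  rewrite y1 => hi x; have hin : (i < n)%N by exact: leq_trans hk.
  have := @triple_leaf n T1 (rotation n k) T2 (Ordinal hin) x.
  rewrite !leaf_itv_part -/e1 -/e2 rotationE //= hi -c2 -c1 !part_cat !add0r.
  rewrite !nth_cat !size_part !size_map y1 y2 hi ltnNge leq_addr addKn /=.
  by [].
rewrite y2 => hi x; have hin : (k + i < n)%N by lia.
have := @triple_leaf n T1 (rotation n k) T2 (Ordinal hin) x.
rewrite !leaf_itv_part -/e1 -/e2 rotationE //= -c2 -c1 !part_cat !add0r.
rewrite !nth_cat !size_part !size_map y1 y2 (ltnNge (k + i)) leq_addr addKn /= hi.
by [].
Qed.

Lemma ktree_val_inj n : injective (@ktree_val n).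
Proof.
move=> [S h] [S' h'] /= e; case: _ / e h' => h'.
by congr KTree; exact: eq_irrelevance.
Qed.

Lemma triple_mul n (T1 T2 T3 : ktree n) p q :
  (triple R T1 p T2 * triple R T2 q T3)%g = triple R T1 (q * p)%g T3.
Proof.
apply: selfbij_ext => x; apply: val_inj.
have hx := leaf_indexP T3 x; set i := leaf_index T3 x in hx.
have /and3P[_ l2 _] := leaf_itvP R T2 (q i).
have /and3P[_ l3 _] := leaf_itvP R T3 i.
have e := triple_leaf T2 q hx.
rewrite [LHS](@triple_leaf n T1 p T2 (q i)); last by rewrite e affine_onto_in.
rewrite e (triple_leaf T1 (q * p)%g hx) permM /affine_onto.
congr (_ + _ * _); rewrite [_ + _ - _]addrAC subrr add0r mulfK //.
by rewrite subr_eq0 gt_eqF.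
Qed.

Lemma represents_tripleP f T1 k T2 : represents f T1 k T2 ->
  exists n (T1' T2' : ktree n), [/\ ktree_val T1' = T1, ktree_val T2' = T2, (k <= n)%N
    & f = triple R T1' (rotation n k) T2'].
Proof.
move=> H; have [e hk] := represents_leaves H.
exists (nleaves T2), (KTree e), (KTree erefl); split => //.
exact: (represents_uniq H (represents_triple (KTree e) (KTree erefl) hk)).
Qed.

Lemma represents_mul f g T1 a T2 b T3 : represents f T1 a T2 -> represents g T2 b T3 ->
  represents (f * g)%g T1 ((a + b) %% nleaves T2) T3.
Proof.
move=> /represents_tripleP[n [S1 [S2 [<- e2 ha ->]]]].
move=> /represents_tripleP[m [S2' [S3 [e2' <- hb ->]]]].
have em : m = n by rewrite -(ktreeP S2) e2 -e2' (ktreeP S2').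
subst m; have -> : S2' = S2.
  by apply: ktree_val_inj; rewrite e2'.
rewrite triple_mul -expgD -/(rotation _ _) addnC rotation_mod -e2 (ktreeP S2).
apply: represents_triple; apply/ltnW/ltn_pmod.
by rewrite -(ktreeP S2) nleaves_gt0.
Qed.

Lemma represents_one T : represents 1%g T 0 T.
Proof.
have [n [S hS]] : exists n (S : ktree n), ktree_val S = T.
  by exists (nleaves T), (KTree erefl).
have H := @represents_triple n S S 0 (leq0n n); rewrite hS in H.
suff <- : triple R S (rotation n 0) S = 1%g by [].
have := triple_mul S S S (rotation n 0) (rotation n 0); rewrite -expgD -/(rotation n 0).
by move=> e; apply: (mulgI (triple R S (rotation n 0) S)); rewrite e mulg1.
Qed.

Lemma represents_inv f T1 T2 : represents f T1 0 T2 -> represents f^-1%g T2 0 T1.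
Proof.
move=> H; have [n [S1 [S2 [<- <- hk ->]]]] := represents_tripleP H.
have K := @represents_triple n S2 S1 0 (leq0n n).
suff -> : ((triple R S1 (rotation n 0) S2)^-1 = triple R S2 (rotation n 0) S1)%g by [].
apply: (mulgI (triple R S1 (rotation n 0) S2)); rewrite mulgV triple_mul -expgD.
have := represents_triple S1 S1 (leq0n n); move/represents_uniq.
by move/(_ _ (represents_one S1)).
Qed.

End Pieces.

(** * The relations hold in the group of transformations *)

Section Relations.
Variable R : realType.
Local Open Scope group_scope.
Local Notation elt := (@Tgen_elt R).

Lemma ncut_yy i s :
  ncut Ycaret i (ncut Ycaret i s) = ncut Xcaret i.+1 (ncut Xcaret i s).
Proof. by elim: s i => [|n s IH] [|i] //=; rewrite IH. Qed.

Lemma exps_spineS n m : exps n (spine m.+1) = ncut Xcaret m (exps n (spine m)).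
Proof. by rewrite -attach_spine exps_attach. Qed.

Lemma represents_attach0 (f : selfbij (Ioc01 R)) T1 T2 c i :
  represents f T1 0 T2 -> (i < nleaves T2)%N ->
  represents f (attach c i T1) 0 (attach c i T2).
Proof. by move=> H hi; have := represents_attach c H hi; rewrite /cut_leaf ltn0 subn0 addn0. Qed.

Lemma represents_cgen c q m : (q <= m)%N ->
  represents (cgen elt c q) (attach c q (spine m.+1)) 0 (spine m.+2).
Proof.
move=> /subnKC <-; elim: (m - q)%N => [|d IH].
  rewrite addn0; have := represents_triple R (kattach c q) (kspine q.+2) (leq0n _).
  by rewrite /rotation expg0; case: c.
rewrite addnS; have hi : ((q + d).+2 < nleaves (spine (q + d).+2))%N by rewrite nleaves_spine.
have := represents_attach0 Xcaret IH hi; apply: represents_exps; last by rewrite attach_spine.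
by rewrite !exps_attach -cut_atC -?exps_spineS ?ltnS ?leq_addr //.
Qed.

(** On the last leaf a y-caret is traded for the x-caret of the spine by y_q ^-1. *)
Lemma represents_cstep c q n : (q <= n)%N ->
  represents (cstep elt c q (q == n)) (attach c q (spine n)) 0 (spine n.+1).
Proof.
rewrite /cstep leq_eqVlt; have [->|ne /= lt] := eqVneq q n; last first.
  by case: n lt {ne} => // n lt; exact: represents_cgen.
move=> _; case: c; first by rewrite attach_spine; exact: represents_one.
apply: represents_inv.
have hk : nleaves (spine n.+1) = n.+2 by rewrite nleaves_spine.
have hk' : nleaves (attach Ycaret n (spine n)) = n.+2 by rewrite nleaves_attach nleaves_spine.
have H := represents_triple R (KTree hk) (KTree hk') (leq0n n.+2).
suff <- : triple R (KTree hk) (rotation n.+2 0) (KTree hk') = cgen elt Ycaret n by [].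
have lt : (n < nleaves (attach Ycaret n (spine n)))%N by rewrite hk'.
have H' := represents_attach0 Ycaret H lt.
apply: represents_uniq H' _; have := represents_cgen Ycaret (leqnn n).
apply: represents_exps => //.
by rewrite !exps_attach ncut_yy !exps_spineS.
Qed.

Lemma represents_mul_cstep f T n c i : represents f T 0 (spine n) -> (i <= n)%N ->
  represents (f * cstep elt c i (i == n)) (attach c i T) 0 (spine n.+1).
Proof.
move=> H hi; have lt : (i < nleaves (spine n))%N by rewrite nleaves_spine ltnS.
have := represents_mul (represents_attach0 c H lt) (represents_cstep c hi).
by rewrite mod0n.
Qed.

Lemma represents_mul_cgen f T n c i : represents f T 0 (spine n) -> (i < n)%N ->
  represents (f * cgen elt c i) (attach c i T) 0 (spine n.+1).
Proof.
by move=> H hi; have := represents_mul_cstep c H (ltnW hi); rewrite (ltn_eqF hi).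
Qed.

Lemma represents_cgen2 c d i j n : (i < n)%N -> (j < n)%N ->
  represents (cgen elt c i * cgen elt d j) (attach d j (attach c i (spine n))) 0 (spine n.+2).
Proof.
move=> hi hj; rewrite -[cgen elt c i]mul1g; apply: represents_mul_cgen; last exact: ltnW.
by apply: represents_mul_cgen => //; exact: represents_one.
Qed.

Lemma cgen_comm c d i j : (i < j)%N ->
  cgen elt d j * cgen elt c i = cgen elt c i * cgen elt d j.+1.
Proof.
move=> ij; have lt : (i < j.+2)%N by lia.
apply: represents_uniq (represents_cgen2 _ _ (leqnSn j.+1) lt) _.
apply: represents_exps (represents_cgen2 _ _ lt (ltnSn _)) => //.
by rewrite !exps_attach -cut_atC.
Qed.

Lemma cgen_sqr n :
  cgen elt Ycaret n * cgen elt Ycaret n = cgen elt Xcaret n * cgen elt Xcaret n.+1.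
Proof.
have h : (n < n.+2)%N by lia.
apply: represents_uniq (represents_cgen2 _ _ h h) _.
apply: represents_exps (represents_cgen2 _ _ h (ltnSn _)) => //.
by rewrite !exps_attach ncut_yy.
Qed.

Lemma represents_rgen m : represents (rgen elt m) (spine m.+2) 1 (spine m.+2).
Proof.
by have := represents_triple R (kspine m.+2) (kspine m.+2) (isT : (1 <= m.+3)%N).
Qed.

Lemma represents_rgenX m k :
  represents (rgen elt m ^+ k) (spine m.+2) (k %% m.+3) (spine m.+2).
Proof.
elim: k => [|k IH]; first by rewrite mod0n expg0; exact: represents_one.
have := represents_mul IH (represents_rgen m).
by rewrite nleaves_spine modnDml addn1 expgSr.
Qed.

(** Both sides arise from c_n by cutting leaf i of the domain and the leaf onto
    which it is mapped. *)
Lemma rgen_attach c m i : (i <= m.+2)%N ->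
  rgen elt m * cstep elt c i (i == m.+2) =
  cstep elt c (rot1 m i) (rot1 m i == m.+2) * rgen elt m.+1 ^+ (i == 0%N).+1.
Proof.
move=> hi; have hr : (rot1 m i <= m.+2)%N by case: i hi => //= i; exact: ltnW.
have lt : (i < nleaves (spine m.+2))%N by rewrite nleaves_spine.
have := represents_attach c (represents_rgen m) lt.
have -> : cut_leaf (nleaves (spine m.+2)) 1 i = rot1 m i.
  by rewrite nleaves_spine /cut_leaf; case: (i) => [|j]; rewrite /= ?addn0 subn1.
have -> : (1 + (i < 1) = (i == 0).+1)%N by case: (i).
move=> H; have H1 := represents_mul H (represents_cstep c hi).
have H2 := represents_mul (represents_cstep c hr) (represents_rgenX m.+1 (i == 0%N).+1).
apply: represents_uniq H1 _; move: H2.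
rewrite nleaves_attach !nleaves_spine // add0n addn0 modn_mod.
by rewrite !modn_small //; case: (i).
Qed.

Lemma Tgen_model : Trel_model elt.
Proof.
have hc n : celt R n.+1 = rgen elt n by [].
have hx n : xelt R n = cgen elt Xcaret n by [].
have hy n : yelt R n = cgen elt Ycaret n by [].
move=> u v [i j ij|i j ij|i j ij|i j ij|n|k n hn kn|n hn|n hn|n hn|k n hn kn|n hn];
  rewrite /= ?hx ?hy ?mulg1; try exact: cgen_comm.
- exact: cgen_sqr.
- case: n hn kn => // n _ kn; rewrite !hc; have := @rgen_attach Xcaret n k.+1 (ltnW kn).
  by rewrite /cstep /= eqSS !ltn_eqF ?expg1 //; lia.
- case: n hn => // n _; rewrite !hc; have := @rgen_attach Xcaret n 0 isT.
  by rewrite /cstep /= eqxx mul1g => ->; rewrite expgS expg1.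
- case: n hn => // n _; rewrite !hc; have := @rgen_attach Xcaret n n.+2 (leqnn _).
  by rewrite /cstep /= eqxx ltn_eqF // mulg1 expg1.
- case: n hn => // n hn.
  have e k : word_eval elt (nseq k (lpos (gc hn))) = rgen elt n ^+ k.
    by elim: k => //= k ->; rewrite expgS.
  transitivity (rgen elt n ^+ n.+3); first exact: (e n.+3).
  have := represents_rgenX n n.+3; rewrite modnn => H.
  exact: represents_uniq H (represents_one _ _).
- case: n hn kn => // n _ kn; rewrite !hc; have := @rgen_attach Ycaret n k.+1 (ltnW kn).
  by rewrite /cstep /= eqSS !ltn_eqF ?expg1 //; lia.
- case: n hn => // n _; rewrite !hc; have := @rgen_attach Ycaret n 0 isT.
  by rewrite /cstep /= eqxx => ->; rewrite expgS expg1.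
Qed.

Lemma attach_ex T : (1 < nleaves T)%N ->
  exists c i T', [/\ T = attach c i T', (i < nleaves T')%N & nleaves T = (nleaves T').+1].
Proof.
suff H : T = Leaf \/ exists c i T', T = attach c i T' /\ (i < nleaves T')%N.
  case: H => [-> //|[c [i [T' [-> hi]]]]] _; exists c, i, T'; split => //.
  by rewrite nleaves_attach.
elim: T => [|c l IHl r IHr]; [by left | right].
case: IHl => [->|[d [i [T' [-> hi]]]]]; last first.
  exists d, i, (Node c T' r) => /=; rewrite hi; split => //.
  by rewrite (leq_trans hi) // leq_addr.
case: IHr => [->|[d [i [T' [-> hi]]]]]; first by exists c, 0%N, Leaf.
by exists d, i.+1, (Node c Leaf T'); rewrite /= subSS subn0 ltnS.
Qed.

Lemma represents_tree_elt T :
  represents (tree_elt elt T 0 true) T 0 (spine (nleaves T).-1).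
Proof.
move: {2}(nleaves T) (leqnn (nleaves T)) => n; elim: n T => [|n IH] T hT.
  by have := nleaves_gt0 T; lia.
have [h|h] := leqP (nleaves T) 1.
  case: T h {hT} => [|c l r] /=; first by move=> _; exact: represents_one.
  by have := nleaves_gt0 l; have := nleaves_gt0 r; lia.
have [c [i [T' [e hi e']]]] := attach_ex h.
rewrite {1 2}e e' (tree_elt_attach Tgen_model) // add0n andTb.
have h' := nleaves_gt0 T'; rewrite -{1 2}(prednK h') eqSS /= -{2}(prednK h').
apply: represents_mul_cstep; last by lia.
by apply: IH; lia.
Qed.

Lemma represents_nf m T1 k T2 : nleaves T1 = m.+3 -> nleaves T2 = m.+3 ->
  represents (nf elt m T1 k T2) T1 (k %% m.+3) T2.
Proof.
move=> h1 h2; have H1 := represents_tree_elt T1; have H2 := represents_tree_elt T2.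
rewrite h1 in H1; rewrite h2 in H2.
have := represents_mul (represents_mul H1 (represents_rgenX m k)) (represents_inv H2).
by rewrite nleaves_spine add0n addn0 !modn_mod.
Qed.

End Relations.

Local Open Scope classical_set_scope.
Local Open Scope quotient_scope.
Local Open Scope ring_scope.

(** * The circle and its covering by the line *)

Section Circle.
Variable R : realType.

Lemma nbhs_setP (A : set R) (x : A) (U : set A) :
  nbhs x U <-> exists2 e, 0 < e & forall y : A, `|val x - val y| < e -> U y.
Proof. exact: (@nbhs_ballP R A). Qed.

Lemma circle_coverD (t : R) (m : int) : circle_cover (t + m%:~R) = circle_cover t.
Proof.
congr (\pi _); apply: val_inj => /=.
by rewrite floorDrz ?intr_int // intrKfloor intrD; ring.
Qed.

Lemma circle_cover_eq (s t : R) :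
  circle_cover s = circle_cover t <-> exists m : int, s = t + m%:~R.
Proof.
split=> [/eqmodP /orP[/eqP /(congr1 val) /= e|]|[m ->]]; last exact: circle_coverD.
  by exists (Num.floor s - Num.floor t); rewrite intrB; lra.
rewrite /circle_end /= => /andP[hs ht].
have int_of (u : R) : (u - (Num.floor u)%:~R == 0) || (u - (Num.floor u)%:~R == 1) ->
    exists m : int, u = m%:~R.
  move=> /orP[/eqP e|/eqP e]; first by exists (Num.floor u); lra.
  by exists (Num.floor u + 1); rewrite intrD; lra.
have [m ->] := int_of s hs; have [n ->] := int_of t ht.
by exists (m - n); rewrite intrB; ring.
Qed.

Lemma circle_cover_repr (z : circle R) : circle_cover (val (generic_quotient.repr z)) = z.
Proof. by rewrite circle_coverE generic_quotient.reprK. Qed.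

Lemma Icc01_ex (t : R) : 0 <= t <= 1 -> exists s : Icc01 R, val s = t.
Proof.
move=> h; have hs : t \in (`[0, 1]%classic : set R) by apply/mem_set; rewrite /= in_itv.
by exists (exist (fun z => z \in (`[0, 1]%classic : set R)) t hs).
Qed.

Lemma Ioc01_ex (t : R) : 0 < t <= 1 -> exists s : Ioc01 R, val s = t.
Proof.
move=> h; have hs : t \in (`]0, 1]%classic : set R) by apply/mem_set; rewrite /= in_itv.
by exists (exist (fun z => z \in (`]0, 1]%classic : set R)) t hs).
Qed.

Lemma Ioc01P (x : Ioc01 R) : 0 < val x <= 1.
Proof. by have /set_mem /= := valP x; rewrite in_itv. Qed.

Lemma circle_cover_continuous : continuous (@circle_cover R).
Proof.
apply/continuousP => A oA; rewrite openE => t At.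
have oW : open ((\pi_(circle R) : Icc01 R -> circle R) @^-1` A) by exact: oA.
set m := Num.floor t; set s0 := t - m%:~R.
have [s00 s01] : 0 <= s0 /\ s0 < 1.
  by rewrite /s0; have := floor_le t; have := floorD1_gt t; rewrite intrD /m; lra.
(* The inverse image of A in [0, 1] contains both 0 and 1 as soon as it
   contains one of them: this is used when t is an integer. *)
have near_pt (y : Icc01 R) : A (\pi y) -> exists2 e, 0 < e & forall z : Icc01 R,
    `|val y - val z| < e -> A (\pi z).
  by move=> Ay; apply/nbhs_setP; exact: open_nbhs_nbhs.
have covE (y : Icc01 R) (s : R) (k : int) : s = val y + k%:~R -> circle_cover s = \pi y.
  by move=> ->; rewrite circle_coverD circle_coverE.
have [y0 hy0] : exists y : Icc01 R, val y = s0 by apply: Icc01_ex; rewrite s00 ltW.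
have Ay0 : A (\pi y0).
  by rewrite -(covE y0 t m) //; rewrite hy0 /s0; ring.
have [e1 e10 H1] := near_pt _ Ay0.
have [s0e|s0n] := eqVneq s0 0; last first.
  have s0p : 0 < s0 by rewrite lt0r s0n.
  apply/nbhs_ballP; exists (Num.min e1 (Num.min s0 (1 - s0))) => /=.
    by rewrite !lt_min e10 s0p subr_gt0.
  move=> s; rewrite /ball /= !lt_min !ltr_norml => /and3P[h1 /andP[h2 h3] /andP[h4 h5]].
  have [y hy] : exists y : Icc01 R, val y = s - m%:~R.
    by apply: Icc01_ex; rewrite /s0 in h2 h3 h4 h5; lra.
  have -> : circle_cover s = \pi y by apply: (covE y s m); rewrite hy; ring.
  by apply: H1; rewrite hy0 hy /s0 ltr_norml; move/andP: h1 => [? ?]; lra.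
have [y1 hy1] : exists y : Icc01 R, val y = 1 by apply: Icc01_ex; rewrite ler01 lexx.
have Ay1 : A (\pi y1).
  suff <- : \pi_(circle R) y0 = \pi y1 by [].
  by rewrite -(covE y1 (val y0) (- 1)) ?circle_coverE // hy0 hy1 s0e; ring.
have [e2 e20 H2] := near_pt _ Ay1.
apply/nbhs_ballP; exists (Num.min e1 (Num.min e2 1)) => /=.
  by rewrite !lt_min e10 e20 ltr01.
move=> s; rewrite /ball /= !lt_min !ltr_norml => /and3P[h1 h2 h3].
have [hst|hst] := leP t s.
  have [y hy] : exists y : Icc01 R, val y = s - m%:~R.
    by apply: Icc01_ex; rewrite /s0 in s0e; move/andP: h3 => [? ?]; lra.
  have -> : circle_cover s = \pi y by apply: (covE y s m); rewrite hy; ring.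
  by apply: H1; rewrite hy0 hy /s0 ltr_norml; move/andP: h1 => [? ?]; lra.
have [y hy] : exists y : Icc01 R, val y = s - m%:~R + 1.
  by apply: Icc01_ex; rewrite /s0 in s0e; move/andP: h3 => [? ?]; lra.
have -> : circle_cover s = \pi y.
  by apply: (covE y s (m - 1)); rewrite hy intrB; ring.
apply: H2; rewrite hy1 hy ltr_norml; rewrite /s0 in s0e.
by move/andP: h2 => [? ?]; lra.
Qed.

Lemma periodic_int (F : R -> R) (m : int) t : (forall t, F (t + 1) = F t + 1) ->
  F (t + m%:~R) = F t + m%:~R.
Proof.
move=> F1; have Fn (n : nat) u : F (u + n%:R) = F u + n%:R.
  by elim: n u => [|n IH] u; rewrite ?addr0 // -natr1 !addrA F1 IH.
case: m => n; first exact: Fn.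
rewrite NegzE mulrNz.
have := Fn n.+1 (t - n.+1%:R); rewrite subrK => ->.
by rewrite -!pmulrn; ring.
Qed.

Definition circle_map (F : R -> R) (z : circle R) : circle R :=
  circle_cover (F (val (generic_quotient.repr z))).

Section CircleMap.
Variable F : R -> R.
Hypothesis F1 : forall t, F (t + 1) = F t + 1.

Lemma circle_mapE t : circle_map F (circle_cover t) = circle_cover (F t).
Proof.
have /circle_cover_eq[m e] := circle_cover_repr (circle_cover t).
by rewrite /circle_map e periodic_int // circle_coverD.
Qed.

Lemma circle_map_continuous : continuous F -> continuous (circle_map F).
Proof.
move=> cF; apply/(@quotient_continuous (Icc01 R) (circle R)).
have -> : circle_map F \o \pi_(circle R) = @circle_cover R \o (F \o val).
  by apply: funext => s /=; rewrite -circle_coverE circle_mapE.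
move=> s; apply: continuous_comp; last exact: circle_cover_continuous.
by apply: continuous_comp; [exact: initial_continuous | exact: cF].
Qed.

End CircleMap.

Lemma increasing_continuous (F G : R -> R) :
  {homo F : s t / s < t} -> cancel G F -> continuous F.
Proof.
move=> Fi GK t; apply/cvgrPdist_lt => e e0.
have Fm := le_mono Fi; have Fl := leW_mono Fm.
near=> s.
have h1 : G (F t - e) < s by near: s; apply: lt_nbhsr; rewrite -Fl GK; lra.
have h2 : s < G (F t + e) by near: s; apply: lt_nbhsl; rewrite -Fl GK; lra.
rewrite -Fl GK in h1; rewrite -Fl GK in h2; rewrite ltr_norml; lra.
Unshelve. all: by end_near. Qed.

(** Monotonicity alone makes such a bijection and its inverse continuous. *)
Lemma lift_homeomorphism (F : R -> R) :
  {homo F : s t / s < t} -> (forall t, F (t + 1) = F t + 1) ->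
  (forall y, exists t, F t = y) ->
  homeomorphism (circle_map F) /\ orientation_preserving (circle_map F).
Proof.
move=> Fi F1 Fs; have [G GK] := choice Fs.
have Finj : injective F := inc_inj (le_mono Fi).
have FK : cancel F G by move=> t; apply: Finj; rewrite GK.
have Gi : {homo G : s t / s < t}.
  by move=> s t st; rewrite -(leW_mono (le_mono Fi)) !GK.
have G1 t : G (t + 1) = G t + 1 by apply: Finj; rewrite GK F1 GK.
have cF := increasing_continuous Fi GK.
split; last by exists F; split => // t; rewrite circle_mapE.
split; first exact: circle_map_continuous.
exists (circle_map G); split; last first.
- apply: circle_map_continuous => //; exact: increasing_continuous Gi FK.
- by move=> z; rewrite -(circle_cover_repr z) !circle_mapE // GK.
- by move=> z; rewrite -(circle_cover_repr z) !circle_mapE // FK.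
Qed.

End Circle.

(** * Rotations of subdivisions are in T_tau *)

Section RotationsInT.
Variable R : realType.
Local Notation tau := (tau R).
Local Notation slen := (slen R).
Local Notation dom_len := (dom_len R).
Local Notation img_len := (img_len R).
Implicit Types (f : selfbij (Ioc01 R)).

Lemma ZtauP (z : R) : Ztau z <-> exists a b : int, z = a%:~R + b%:~R * tau.
Proof.
split=> [[p ->]|[a [b ->]]]; last first.
  exists (a%:P + b%:P * 'X)%R.
  by rewrite rmorphD rmorphM /= !map_polyC map_polyX hornerD hornerM !hornerC hornerX.
elim/poly_ind: p => [|p c [a [b e]]]; first by exists 0, 0; rewrite rmorph0 horner0; ring.
exists (b + c), (a - b).
rewrite rmorphD rmorphM /= map_polyC map_polyX hornerD hornerM hornerC hornerX e.
rewrite intrD intrB mulrDl -mulrA -expr2 tau_sqr; ring.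
Qed.

Lemma ZtauD (y z : R) : Ztau y -> Ztau z -> Ztau (y + z).
Proof.
move=> /ZtauP[a [b ->]] /ZtauP[c [d ->]]; apply/ZtauP.
by exists (a + c), (b + d); rewrite !intrD; ring.
Qed.

Lemma ZtauN (y : R) : Ztau y -> Ztau (- y).
Proof.
by move=> /ZtauP[a [b ->]]; apply/ZtauP; exists (- a), (- b); rewrite !mulrNz; ring.
Qed.

Lemma ZtauX n : Ztau (tau ^+ n).
Proof. by exists 'X^n; rewrite map_polyXn hornerXn. Qed.

Lemma Ztau0 : Ztau (0 : R). Proof. by exists 0; rewrite rmorph0 horner0. Qed.

Lemma Ztau_slen s : Ztau (slen s).
Proof.
elim: s => [|n s IH]; first by rewrite slen_nil; exact: Ztau0.
by rewrite slen_cons; apply: ZtauD IH; exact: ZtauX.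
Qed.

Lemma piecesP u v s p : p \in pieces u v s -> exists2 q : nat * nat,
  p = ((p.1.1, p.1.1 + tau ^+ q.1), (p.2.1, p.2.1 + tau ^+ q.2)) &
  (Ztau u -> Ztau p.1.1 /\ Ztau p.1.2).
Proof.
elim: s u v => //= q s IH u v; rewrite inE => /predU1P[->|/IH [q' e H]].
  by exists q => //= Zu; split=> //; apply: ZtauD => //; exact: ZtauX.
by exists q' => // Zu; apply: H; apply: ZtauD => //; exact: ZtauX.
Qed.

Lemma agree_image f u v s x : agree f (pieces u v s) ->
  u < val x <= u + dom_len s -> v < val (f x) <= v + img_len s.
Proof.
elim: s u v => [|p s IH] u v /=.
  by move=> _; rewrite /dom_len slen_nil addr0 => /andP[h /(lt_le_trans h)]; rewrite ltxx.
move=> /agree_cons[/= h H] /andP[h1]; rewrite /dom_len /img_len /= !slen_cons !addrA => h2.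
have t0 := tauX_gt0 R p.2.
have [hx|hx] := leP (val x) (u + tau ^+ p.1).
  have hin : in_oc (val x) (u, u + tau ^+ p.1) by rewrite /in_oc h1.
  have lt n (w : R) : (w, w + tau ^+ n).1 < (w, w + tau ^+ n).2 by rewrite ltrDl tauX_gt0.
  rewrite h //; have /andP[/= -> h3] := affine_onto_in (lt _ _) (lt p.2 v) hin.
  by rewrite (le_trans h3) // lerDl slen_ge0.
have := IH _ _ H; rewrite hx => /(_ h2) /andP[h3 ->].
by rewrite (lt_trans _ h3) ?ltrDl.
Qed.

Lemma agree_incr f u v s (x y : Ioc01 R) : agree f (pieces u v s) ->
  u < val x -> val x < val y -> val y <= u + dom_len s -> val (f x) < val (f y).
Proof.
elim: s u v => [|p s IH] u v /=.
  by move=> _ ux xy; rewrite /dom_len slen_nil addr0 => h; lra.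
move=> /agree_cons[/= h H] ux xy; rewrite /dom_len /= slen_cons addrA => h2.
have t0 := tauX_gt0 R p.2; have t1 := tauX_gt0 R p.1.
have [hy|hy] := leP (val y) (u + tau ^+ p.1).
  rewrite !h; last 2 first.
  - by rewrite /in_oc /= hy (lt_trans ux).
  - by rewrite /in_oc /= ux ltW // (lt_le_trans xy).
  by rewrite !affine_onto_len ltrD2l ltr_pM2r // ltr_pM2r ?invr_gt0 // ltrD2r.
have [hx|hx] := leP (val x) (u + tau ^+ p.1); last exact: IH H hx xy h2.
have := @agree_image f _ _ _ y H; rewrite hy => /(_ h2) /andP[h3 _].
apply: le_lt_trans h3.
have h1 : agree f (pieces u v [:: p]) by apply/agree_cons; split.
have := @agree_image f u v [:: p] x h1.
by rewrite /img_len /dom_len /= !slen_cons !slen_nil !addr0 ux hx => /(_ isT)/andP[].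
Qed.

Lemma agree_pl_tau f P : (forall x : Ioc01 R, exists2 p, p \in P & in_oc (val x) p.1) ->
  (forall p, p \in P -> exists2 q : nat * nat,
     p = ((p.1.1, p.1.1 + tau ^+ q.1), (p.2.1, p.2.1 + tau ^+ q.2)) &
     Ztau p.1.1 /\ Ztau p.1.2) ->
  agree f P -> left_continuous f /\ pl_tau f.
Proof.
move=> Pcover Pform Pf; split.
  move=> t U /nbhs_setP [e e0 HU].
  have [p pP /andP[pt tp]] := Pcover t.
  have [[d r] /= ep _] := Pform p pP.
  have d0 := tauX_gt0 R d; have r0 := tauX_gt0 R r.
  suff : nbhs t [set s : Ioc01 R | val s < val t -> U (f s)] by [].
  apply/nbhs_setP; exists (Num.min (val t - p.1.1) (e * (tau ^+ d / tau ^+ r))).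
    by rewrite lt_min subr_gt0 pt mulr_gt0 // divr_gt0.
  move=> s; rewrite lt_min => /andP[h1 h2] st; apply: HU.
  rewrite ger0_norm ?subr_ge0 ?(ltW st) // in h1 h2.
  rewrite (Pf p pP t) ?(Pf p pP s); last 2 first.
  - by rewrite /in_oc (le_trans (ltW st)) // andbT; lra.
  - by rewrite /in_oc pt.
  rewrite ep !affine_onto_len opprD addrACA subrr add0r -!mulrBl opprB addrA subrK.
  rewrite ger0_norm; last by rewrite !mulr_ge0 ?invr_ge0 ?subr_ge0 // ltW.
  by rewrite -ltr_pdivlMr // -ltr_pdivlMr ?invr_gt0 // invrK -mulrA [_^-1 * _]mulrC.
exists ([seq p.1.1 | p <- P] ++ [seq p.1.2 | p <- P]).
  by move=> z; rewrite mem_cat => /orP[] /mapP[p /Pform[q _ [h1 h2]] ->].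
move=> u v u0 uv v1 Hb.
have [t ht] : exists t : Ioc01 R, val t = (u + v) / 2 by apply: Ioc01_ex; lra.
have [p pP /andP[pt tp]] := Pcover t.
have [[d r] /= ep _] := Pform p pP.
have hu : p.1.1 <= u.
  rewrite leNgt; apply/negP => h; apply: (Hb p.1.1).
    by rewrite mem_cat (map_f (fun p : (R * R) * (R * R) => p.1.1)).
  by rewrite h; lra.
have hv : v <= p.1.2.
  rewrite leNgt; apply/negP => h; apply: (Hb p.1.2).
    by rewrite mem_cat (map_f (fun p : (R * R) * (R * R) => p.1.2)) ?orbT.
  by rewrite h andbT; lra.
exists (r%:Z - d%:Z), (p.2.1 - p.1.1 * (tau ^+ r / tau ^+ d)) => s /andP[us sv].
rewrite (Pf p pP); last first.
  by rewrite /in_oc (le_lt_trans hu us) (le_trans (ltW sv)).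
rewrite ep affine_onto_len /=.
have -> : tau ^ (r%:Z - d%:Z) = tau ^+ r / tau ^+ d.
  by rewrite expfzDr ?lt0r_neq0 ?tau_gt0 // -exprnN.
by ring.
Qed.

(** When 1 is added to its values beyond L, f becomes increasing; the extension
    that commutes with the unit translation is a lift to the line. *)
Lemma turning_circle f (L A : R) : 0 <= A <= 1 ->
  (forall x : Ioc01 R, val x <= L -> A < val (f x)) ->
  (forall x : Ioc01 R, L < val x -> val (f x) <= A) ->
  (forall x y : Ioc01 R, val x < val y -> val y <= L -> val (f x) < val (f y)) ->
  (forall x y : Ioc01 R, L < val x -> val x < val y -> val (f x) < val (f y)) ->
  exists h : circle R -> circle R, [/\ homeomorphism h, orientation_preserving h &
    forall t : Ioc01 R, h (circle_cover (val t)) = circle_cover (val (f t))].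
Proof.
move=> /andP[A0 A1] fle fgt incl incr.
have sub (t : R) : exists x : Ioc01 R, val x = t - (Num.ceil t - 1)%:~R.
  by apply: Ioc01_ex; rewrite intrB; have := ceil_ge t; have := ceilB1_lt t; rewrite intrB; lra.
(* q t is the point of (0, 1] congruent to t modulo 1, and up is the lift on
   (0, 1]. *)
have [q qE] := choice sub.
pose up (x : Ioc01 R) : R := if val x <= L then val (f x) else val (f x) + 1.
pose F t := up (q t) + (Num.ceil t - 1)%:~R.
have upA x : A < up x <= A + 1.
  have /andP[h0 h1] := Ioc01P (f x).
  by rewrite /up; case: (leP (val x) L) => hx; [have := fle x hx | have := fgt x hx]; lra.
have up_incr x y : val x < val y -> up x < up y.
  move=> xy; have /andP[_ h1] := Ioc01P (f x); have /andP[h0 _] := Ioc01P (f y).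
  rewrite /up; case: (leP (val x) L) => hx; case: (leP (val y) L) => hy; first exact: incl.
  - by lra.
  - by have := lt_le_trans hx (le_trans (ltW xy) hy); rewrite ltxx.
  - by rewrite ltrD2r; exact: incr.
have q_eq (x : Ioc01 R) (m : int) : q (val x + m%:~R) = x /\ Num.ceil (val x + m%:~R) = m + 1.
  have /andP[x0 x1] := Ioc01P x.
  have e : Num.ceil (val x + m%:~R) = m + 1.
    by apply: ceil_def; rewrite addrK intrD; lra.
  by split => //; apply: val_inj; rewrite qE e addrK; ring.
have FE (x : Ioc01 R) (m : int) : F (val x + m%:~R) = up x + m%:~R.
  by rewrite /F; have [-> ->] := q_eq x m; rewrite addrK.
have dec (t : R) : exists (x : Ioc01 R) (m : int), t = val x + m%:~R.
  by exists (q t), (Num.ceil t - 1); rewrite qE subrK.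
have Fi : {homo F : s t / s < t}.
  move=> s t; have [x [m ->]] := dec s; have [y [n ->]] := dec t; rewrite !FE => st.
  have /andP[x0 x1] := Ioc01P x; have /andP[y0 y1] := Ioc01P y.
  have /andP[ux _] := upA y; have /andP[_ uy] := upA x.
  have [mn|nm|e] := ltgtP m n.
  - have : (m + 1)%:~R <= n%:~R :> R by rewrite ler_int lezD1.
    by rewrite intrD; lra.
  - have : (n + 1)%:~R <= m%:~R :> R by rewrite ler_int lezD1.
    by rewrite intrD; lra.
  - by rewrite e in st *; rewrite ltrD2r in st; rewrite ltrD2r; exact: up_incr.
have F1 t : F (t + 1) = F t + 1.
  have [x [m ->]] := dec t.
  by rewrite -addrA -[1]/(1%:~R) -intrD !FE intrD addrA.
have Fs y : exists t, F t = y.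
  pose m := Num.ceil (y - A) - 1.
  have [z1 z2] : A < y - m%:~R /\ y - m%:~R <= A + 1.
    rewrite /m intrB; have := ceil_ge (y - A); have := ceilB1_lt (y - A).
    by rewrite intrB; lra.
  have [h|h] := leP (y - m%:~R) 1.
    have [z ez] : exists z : Ioc01 R, val z = y - m%:~R by apply: Ioc01_ex; lra.
    exists (val (sb_inv f z) + m%:~R); rewrite FE /up sb_invK.
    case: (leP _ L) => hx; first by rewrite ez subrK.
    by have := fgt _ hx; rewrite sb_invK ez; lra.
  have [z ez] : exists z : Ioc01 R, val z = y - m%:~R - 1.
    by apply: Ioc01_ex; lra.
  exists (val (sb_inv f z) + m%:~R); rewrite FE /up sb_invK.
  case: (leP _ L) => hx; last by rewrite ez; ring.
  by have := fle _ hx; rewrite sb_invK ez; lra.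
have [hh ho] := lift_homeomorphism Fi F1 Fs.
exists (circle_map F); split => // t; rewrite circle_mapE //.
have := FE t 0; rewrite addr0 => ->; rewrite addr0 /up.
by case: ifP => // _; rewrite -[1]/(1%:~R) circle_coverD.
Qed.

Lemma represents_Ttau f T1 k T2 : represents f T1 k T2 -> Ttau f.
Proof.
move=> [s1 [s2 [_ h2 h1 Hf]]].
have eL : dom_len s1 + dom_len s2 = 1.
  by rewrite /dom_len -slen_cat -map_cat h2 slen_exps.
have eA : img_len s2 + img_len s1 = 1.
  by rewrite /img_len -slen_cat -map_cat h1 slen_exps.
have [L0 A0] : 0 <= dom_len s1 /\ 0 <= img_len s2 by rewrite /dom_len /img_len !slen_ge0.
have i0 : 0 <= img_len s1 by rewrite /img_len slen_ge0.
have [H1 H2] := (agree_cat _ _ _).1 Hf.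
split; last first.
  apply: (@turning_circle f (dom_len s1) (img_len s2)); first by lra.
  - move=> x hx; have /andP[x0 _] := Ioc01P x.
    by have := agree_image H1; rewrite add0r => /(_ x); rewrite x0 hx => /(_ isT)/andP[].
  - move=> x hx; have /andP[_ x1] := Ioc01P x.
    by have := agree_image H2; rewrite add0r => /(_ x); rewrite hx eL x1 => /(_ isT)/andP[].
  - move=> x y xy hy; have /andP[x0 _] := Ioc01P x.
    by apply: agree_incr H1 x0 xy _; rewrite add0r.
  - move=> x y hx xy; have /andP[_ y1] := Ioc01P y.
    by apply: agree_incr H2 hx xy _; rewrite eL.
apply: agree_pl_tau Hf => [x|p].
  have /andP[x0 x1] := Ioc01P x; have [h|h] := leP (val x) (dom_len s1).
    have [|p hp hx] := @pieces_cover R 0 (img_len s2) s1 (val x).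
      by rewrite x0 add0r.
    by exists p; rewrite // mem_cat hp.
  have [|p hp hx] := @pieces_cover R (dom_len s1) 0 s2 (val x).
    by rewrite h eL.
  by exists p; rewrite // mem_cat hp orbT.
rewrite mem_cat => /orP[] /piecesP[q e Z]; exists q => //; apply: Z.
  exact: Ztau0.
exact: Ztau_slen.
Qed.

(** * Elements of T_tau are rotations of subdivisions *)

Lemma fib_levels n (a b : int) N : (`|a| + `|b| <= n)%N ->
  0 < a%:~R * tau ^+ N + b%:~R * tau ^+ N.+1 ->
  exists (N' a' b' : nat), (N <= N')%N /\
    a%:~R * tau ^+ N + b%:~R * tau ^+ N.+1 = a'%:R * tau ^+ N' + b'%:R * tau ^+ N'.+1.
Proof.
have nonpos (a' b' : int) M : a' <= 0 -> b' <= 0 ->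
    ~ 0 < a'%:~R * tau ^+ M + b'%:~R * tau ^+ M.+1.
  move=> a0 b0; apply/negP; rewrite -leNgt.
  by rewrite -[leRHS]addr0 lerD // mulr_le0_ge0 ?lerz0 // ltW // tauX_gt0.
elim: n a b N => [|n IH] a b N hn pos.
  by case: (nonpos a b N) => //; lia.
have [/andP[a0 b0]|hab] := boolP ((0 <= a) && (0 <= b)).
  by exists N, `|a|%N, `|b|%N; split=> //; rewrite !natr_absz !ger0_norm.
have e : a%:~R * tau ^+ N + b%:~R * tau ^+ N.+1 =
         (a + b)%:~R * tau ^+ N.+1 + a%:~R * tau ^+ N.+2.
  by rewrite -(tauX R N) intrD; ring.
have h1 : ~~ ((a <= 0) && (b <= 0)) by apply/negP => /andP[? ?]; exact: nonpos pos.
rewrite e in pos *.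
have h2 : ~~ ((a + b <= 0) && (a <= 0)) by apply/negP => /andP[? ?]; exact: nonpos pos.
have [/andP[a0 b0]|hab'] := boolP ((0 <= a + b) && (0 <= a)).
  by exists N.+1, `|(a + b)%R|%N, `|a|%N; split=> //; rewrite !natr_absz !ger0_norm.
have [|N' [a' [b' [hN ->]]]] := IH _ _ _ _ pos; first by lia.
by exists N', a', b'; split => //; exact: ltnW.
Qed.

(** Rewriting tau ^ N = tau ^ (N + 1) + tau ^ (N + 2) acts on the pair of
    coefficients as (a, b) |-> (a + b, a), which reaches equal signs. *)
Lemma Ztau_levels z M : Ztau z -> 0 < z ->
  exists N a b : nat, (M <= N)%N /\ z = a%:R * tau ^+ N + b%:R * tau ^+ N.+1.
Proof.
move=> /ZtauP[a [b ->]] pos.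
have [a' [b' e]] : exists a' b' : int,
    a%:~R + b%:~R * tau = a'%:~R * tau ^+ M + b'%:~R * tau ^+ M.+1.
  elim: M => [|M [a' [b' ->]]]; first by exists a, b; rewrite expr0 mulr1 expr1.
  by exists (a' + b'), a'; rewrite -(tauX R M) intrD; ring.
rewrite e in pos *.
by have [N [a1 [b1 [h ->]]]] := fib_levels (leqnn _) pos; exists N, a1, b1.
Qed.

Lemma affine_closure (F : R -> R) (a c p q : R) : continuous F -> p < q ->
  (forall t, p < t < q -> F t = a * t + c) ->
  forall t, p <= t <= q -> F t = a * t + c.
Proof.
move=> cF pq H w /andP[pw wq].
apply/eqP; rewrite -subr_eq0; apply/eqP; apply: contrapT => /eqP ne.
pose G t := F t - (a * t + c).
have cG : continuous G.
  move=> t; apply: cvgB; first exact: cF.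
  by apply: cvgD; [apply: cvgMr; exact: cvg_id | exact: cvg_cst].
have /cvgrPdist_lt/(_ `|G w|) := cG w; rewrite normr_gt0 => /(_ ne).
move=> /nbhs_ballP[e /= e0 He].
have [t [ht1 ht2]] : exists t, p < t < q /\ `|w - t| < e.
  have [hw|hw] := ltP w q.
    exists (w + Num.min (e / 2) ((q - w) / 2)).
    have m0 : 0 < Num.min (e / 2) ((q - w) / 2) by rewrite lt_min; lra.
    have m1 : Num.min (e / 2) ((q - w) / 2) <= e / 2 by rewrite ge_min lexx.
    have m2 : Num.min (e / 2) ((q - w) / 2) <= (q - w) / 2 by rewrite ge_min lexx orbT.
    by rewrite ltr_norml; split; lra.
  exists (w - Num.min (e / 2) ((w - p) / 2)).
  have m0 : 0 < Num.min (e / 2) ((w - p) / 2) by rewrite lt_min; lra.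
  have m1 : Num.min (e / 2) ((w - p) / 2) <= e / 2 by rewrite ge_min lexx.
  have m2 : Num.min (e / 2) ((w - p) / 2) <= (w - p) / 2 by rewrite ge_min lexx orbT.
  by rewrite ltr_norml; split; lra.
by have := He t ht2; rewrite /= {2}/G (H t ht1) subrr subr0 ltxx.
Qed.

Definition affine_pieces (F : R -> R) (P : seq ((R * R) * (R * R))) := forall p, p \in P ->
  forall t, in_oc t p.1 -> F t = affine_onto p.1 p.2 t.

Lemma affine_pieces_line (F : R -> R) (a c p q u : R) s :
  (forall t, p <= t <= q -> F t = a * t + c) ->
  (forall e, e \in s -> tau ^+ e.2 = a * tau ^+ e.1) ->
  p <= u -> u + dom_len s <= q -> affine_pieces F (pieces u (F u) s).
Proof.
move=> H; elim: s u => //= e s IH u He pu.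
rewrite /dom_len /= slen_cons addrA => uq.
have t1 := tauX_gt0 R e.1; have s0 := slen_ge0 R (map fst s).
have h := He e (mem_head _ _).
have Fu : F (u + tau ^+ e.1) = F u + tau ^+ e.2.
  by rewrite !H ?h; [ring | lra | lra].
move=> P; rewrite inE => /predU1P[-> t /andP[/= ut tu]|].
  rewrite affine_onto_len !H ?h; [|lra..].
  by field; rewrite lt0r_neq0.
rewrite -Fu; apply: IH => //; last by lra.
by move=> e' he'; apply: He; rewrite inE he' orbT.
Qed.

(** Levels N >= |k| keep the exponents N + k of the images natural. *)
Lemma subdivide_line (F : R -> R) (k : int) (c p q : R) : p < q -> Ztau (q - p) ->
  (forall t, p <= t <= q -> F t = tau ^ k * t + c) ->
  exists s, [/\ p + dom_len s = q, F p + img_len s = F q &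
    affine_pieces F (pieces p (F p) s)].
Proof.
move=> pq Zpq H; have pos : 0 < q - p by rewrite subr_gt0.
have [N [a [b [hN e]]]] := Ztau_levels `|k|%N Zpq pos.
have [N' eN] : exists N' : nat, N'%:Z = N%:Z + k by exists `|(N%:Z + k)%R|%N; lia.
have eX n : tau ^+ (N' + n) = tau ^ k * tau ^+ (N + n).
  rewrite !exprnP -expfzDr ?lt0r_neq0 ?tau_gt0 //.
  by congr (_ ^ _); rewrite !PoszD eN; ring.
have eX0 : tau ^+ N' = tau ^ k * tau ^+ N by have := eX 0%N; rewrite !addn0.
have eX1 : tau ^+ N'.+1 = tau ^ k * tau ^+ N.+1 by have := eX 1%N; rewrite !addn1.
pose s := nseq a (N, N') ++ nseq b (N.+1, N'.+1).
have ed : dom_len s = q - p.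
  by rewrite /dom_len map_cat !map_nseq slen_cat !slen_nseq -e.
have ei : img_len s = tau ^ k * (q - p).
  by rewrite /img_len map_cat !map_nseq slen_cat !slen_nseq /= eX0 eX1 e; ring.
exists s; split; first by rewrite ed; ring.
  by rewrite ei !H; [ring | lra | lra].
apply: affine_pieces_line H _ _ _; [|lra|by rewrite ed; lra].
by move=> x; rewrite mem_cat => /orP[] /nseqP[-> _].
Qed.

Lemma subdivide (F : R -> R) (b : seq R) (p q : R) : continuous F ->
  (forall z, z \in b -> Ztau z) -> p < q -> Ztau p -> Ztau q ->
  (forall u v, p <= u -> u < v -> v <= q -> (forall z, z \in b -> ~ (u < z < v)) ->
     exists (k : int) (c : R), forall t, u < t < v -> F t = tau ^ k * t + c) ->
  exists s, [/\ p + dom_len s = q, F p + img_len s = F q &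
    affine_pieces F (pieces p (F p) s)].
Proof.
move=> cF; elim: b p q => [|z b IH] p q Zb pq Zp Zq H.
  have [k [c Hk]] := H p q (lexx _) pq (lexx _) (fun _ => ltac:(by [])).
  apply: subdivide_line (affine_closure cF pq Hk) => //.
  by apply: ZtauD => //; exact: ZtauN.
have Zz := Zb z (mem_head _ _).
have Zb' y : y \in b -> Ztau y by move=> hy; apply: Zb; rewrite inE hy orbT.
have [/andP[pz zq]|hz] := boolP (p < z < q); last first.
  apply: IH => // u v pu uv vq Hb; apply: H => // y; rewrite inE => /predU1P[->|/Hb //].
  move=> /andP[uz zv]; move/negP: hz; apply.
  by rewrite (le_lt_trans pu uz) (lt_le_trans zv vq).
have [|s1 [e1 e2 e3]] := IH p z Zb' pz Zp Zz.
  move=> u v pu uv vq Hb; apply: H => //; first exact: le_trans (ltW zq).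
  by move=> y; rewrite inE => /predU1P[->|/Hb //] /andP[uz zv]; lra.
have [|s2 [e1' e2' e3']] := IH z q Zb' zq Zz Zq.
  move=> u v pu uv vq Hb; apply: H => //; first exact: le_trans (ltW pz) _.
  by move=> y; rewrite inE => /predU1P[->|/Hb //] /andP[uz zv]; lra.
exists (s1 ++ s2); split.
- by rewrite /dom_len map_cat slen_cat addrA -/(dom_len s1) e1.
- by rewrite /img_len map_cat slen_cat addrA -/(img_len s1) e2.
move=> P; rewrite pieces_cat e1 e2 mem_cat => /orP[]; [exact: e3 | exact: e3'].
Qed.


(** The lift may be normalized to start in [0, 1) at 0; since the circle map is
    injective, it gains exactly one turn on [0, 1]. *)
Lemma Ttau_lift f : Ttau f -> exists F : R -> R,
  [/\ continuous F, {homo F : s t / s < t}, 0 <= F 0 < 1, F 1 = F 0 + 1 &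
    forall x : Ioc01 R, val (f x) = if F (val x) <= 1 then F (val x) else F (val x) - 1].
Proof.
move=> [_ [h [[_ [h' [hK _ _]]] [F0 [cF0 iF0 hF0]] hf]]].
have hinj : injective h := can_inj hK.
have cover1 : circle_cover (1 : R) = circle_cover 0.
  by apply/circle_cover_eq; exists 1; rewrite add0r.
(* d is the degree of the circle map. *)
have [d ed] : exists d : int, F0 1 = F0 0 + d%:~R.
  by apply/circle_cover_eq; rewrite !hF0 cover1.
clear cover1.
have d0 : 0 < d.
  by have := iF0 0 1 ltr01; rewrite ed ltrDl ltr0z.
have d1 : d = 1.
  apply/eqP; rewrite eq_le andbC -gtz0_ge1 d0 leNgt /=; apply/negP => d2.
  have hd : 2%:~R <= d%:~R :> R by rewrite ler_int.
  have [c] : exists2 c, c \in `[(0 : R), 1] & F0 c = F0 0 + 1.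
    apply: IVT => //; first exact: continuous_subspaceT.
    by rewrite ge_min le_max ed; apply/andP; split; apply/orP; [left | right]; lra.
  rewrite in_itv /= => /andP[c0 c1] ec.
  have : circle_cover (F0 c) = circle_cover (F0 0).
    by apply/circle_cover_eq; exists 1; rewrite ec.
  rewrite !hF0 => /hinj /circle_cover_eq [m]; rewrite add0r => em.
  have [m0|m1] : m = 0 \/ m = 1.
    by move: c0 c1; rewrite em ler0z -[1]/(1%:~R) ler_int; lia.
  - by rewrite em m0 in ec; rewrite ?mulr0z in ec; lra.
  - by rewrite em m1 ed in ec; lra.
pose m := Num.floor (F0 0); pose F t := F0 t - m%:~R.
have [F00 F01] : 0 <= F 0 /\ F 0 < 1.
  by rewrite /F /m; have := floor_le (F0 0); have := floorD1_gt (F0 0); rewrite intrD; lra.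
have iF : {homo F : s t / s < t} by move=> s t st; rewrite ltrD2r; exact: iF0.
have F1 : F 1 = F 0 + 1 by rewrite /F ed d1; ring.
exists F; split => //; first by move=> t; apply: cvgB; [exact: cF0 | exact: cvg_cst].
  by rewrite F00.
move=> x; have /andP[x0 x1] := Ioc01P x; have /andP[f0 f1] := Ioc01P (f x).
have h0 := iF _ _ x0.
have h1 : F (val x) <= F 1 by exact: (ltW_homo iF).
have [n en] : exists n : int, F (val x) = val (f x) + n%:~R.
  have /circle_cover_eq[n e] : circle_cover (F0 (val x)) = circle_cover (val (f x)).
    by rewrite hF0 hf.
  by exists (n - m); rewrite /F e intrB; ring.
have n1 : n%:~R < 2%:~R :> R by lra.
have n0 : (-1)%:~R < n%:~R :> R by rewrite mulrNz; lra.
rewrite !ltr_int in n0 n1.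
have [n0'|n1'] : n = 0 \/ n = 1 by clear -n0 n1; lia.
  by rewrite en n0' addr0 f1.
by rewrite en n1'; case: leP => h2; lra.
Qed.

Lemma avoid_seq (b : seq R) (L : R) : 0 < L < 1 -> L \notin b ->
  exists u v, [/\ 0 <= u, u < L, L < v, v <= 1 & forall z, z \in b -> ~ (u < z < v)].
Proof.
move=> /andP[L0 L1]; elim: b => [_|z b IH]; first by exists 0, 1; split.
rewrite inE negb_or => /andP[nz /IH [u [v [u0 uL Lv v1 H]]]].
have [zL|Lz|e] := ltgtP z L; last by rewrite e eqxx in nz.
  exists (Num.max u z), v; rewrite le_max u0 gt_max uL zL; split => // y.
  rewrite inE gt_max => /predU1P[->|/H h /andP[/andP[h1 _] h2]].
    by rewrite ltxx andbF.
  by apply: h; rewrite h1.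
exists u, (Num.min v z); rewrite ge_min v1 lt_min Lv Lz; split => // y.
rewrite inE lt_min => /predU1P[->|/H h /andP[h1 /andP[h2 _]]].
  by rewrite ltxx !andbF.
by apply: h; rewrite h1.
Qed.

(** If L < 1, then f drops from 1 to values near 0 behind L, whereas it increases between
    break points; so L is a break point. *)
Lemma Ztau_jump f (F : R -> R) (L : R) : pl_tau f -> 0 < L <= 1 -> F L = 1 ->
  {homo F : s t / s < t} -> F 1 < 2 ->
  (forall x : Ioc01 R, val (f x) = if F (val x) <= 1 then F (val x) else F (val x) - 1) ->
  Ztau L.
Proof.
move=> [b Zb Hb] /andP[L0]; rewrite le_eqVlt => /predU1P[-> *|L1].
  exact: (ZtauX 0).
move=> FL iF F1 fE; have [/Zb //|nb] := boolP (L \in b).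
have [|u [v [u0 uL Lv v1 H]]] := avoid_seq _ nb; first by rewrite L0.
have [k [c Hk]] := Hb u v u0 (lt_trans uL Lv) v1 H.
have [x hx] : exists x : Ioc01 R, val x = L by apply: Ioc01_ex; rewrite L0 ltW.
have [y hy] : exists y : Ioc01 R, val y = (L + v) / 2 by apply: Ioc01_ex; lra.
have Ly : L < (L + v) / 2 by lra.
have := Hk x; rewrite hx uL Lv fE hx FL lexx => /(_ isT) e1.
have Fy : 1 < F ((L + v) / 2) by rewrite -[ltLHS]FL iF.
have := Hk y; rewrite hy fE hy leNgt Fy /= => e2.
have h1 : F ((L + v) / 2) < F 1 by apply: iF; clear -Lv v1; lra.
have h2 : tau ^ k * L < tau ^ k * ((L + v) / 2).
  by rewrite ltr_pM2l // exprz_gt0 // tau_gt0.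
have {}e2 : F ((L + v) / 2) - 1 = tau ^ k * ((L + v) / 2) + c.
  by apply: e2; rewrite (lt_trans uL Ly) /=; clear -Lv; lra.
by clear -h1 h2 e1 e2 F1; lra.
Qed.

Lemma Ttau_rotates f : Ttau f -> exists s1 s2,
  [/\ dom_len (s1 ++ s2) = 1, img_len (s2 ++ s1) = 1 & rotates f s1 s2].
Proof.
move=> Tf; have [F [cF iF /andP[F00 F01] F1 fE]] := Ttau_lift Tf.
have [[_ plf] _] := Tf.
have [L] : exists2 L, L \in `[(0 : R), 1] & F L = 1.
  apply: IVT => //; first exact: continuous_subspaceT.
  by rewrite ge_min le_max F1; apply/andP; split; apply/orP; [left | right]; lra.
rewrite in_itv /= => /andP[L0 L1] FL.
have {}L0 : 0 < L.
  by rewrite lt_def L0 andbT; apply/eqP => e; rewrite e in FL; lra.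
have ZL : Ztau L.
  by apply: (Ztau_jump plf _ FL iF _ fE); [rewrite L0 | lra].
have [b Zb Hb] := plf.
have leF := ltW_homo iF.
have [s1 [e1 e2 e3]] : exists s, [/\ 0 + dom_len s = L, F 0 + img_len s = F L &
    affine_pieces F (pieces 0 (F 0) s)].
  apply: (subdivide cF Zb L0 Ztau0 ZL) => u v u0 uv vL H.
  have [k [c Hk]] := Hb u v u0 uv (le_trans vL L1) H; exists k, c => t /andP[ut tv].
  have [x hx] : exists x : Ioc01 R, val x = t by apply: Ioc01_ex; lra.
  have := Hk x; rewrite hx fE hx ut tv; have -> : F t <= 1.
    by rewrite -[leRHS]FL; apply: leF; lra.
  by apply.
(* Beyond L the values of the lift exceed 1. *)
pose F' t := F t - 1.
have cF' : continuous F' by move=> t; apply: cvgB; [exact: cF | exact: cvg_cst].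
have [s2 [e4 e5 e6]] : exists s, [/\ L + dom_len s = 1, F' L + img_len s = F' 1 &
    affine_pieces F' (pieces L (F' L) s)].
  move: L1; rewrite le_eqVlt => /predU1P[->|L1].
    by exists [::]; rewrite /dom_len /img_len !slen_nil !addr0.
  apply: (subdivide cF' Zb L1 ZL (ZtauX 0)) => u v Lu uv v1 H.
  have [k [c Hk]] := Hb u v (le_trans (ltW L0) Lu) uv v1 H; exists k, c => t /andP[ut tv].
  have [x hx] : exists x : Ioc01 R, val x = t by apply: Ioc01_ex; lra.
  have := Hk x; rewrite hx fE hx ut tv leNgt.
  have -> /= : 1 < F t by rewrite -[ltLHS]FL iF; lra.
  by apply.
rewrite add0r in e1; rewrite FL in e2.
have eF' : F' L = 0 by rewrite /F' FL subrr.
have eA : img_len s2 = F 0 by move: e5; rewrite eF' /F' F1; lra.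
exists s1, s2; split.
- by rewrite /dom_len map_cat slen_cat -/(dom_len s1) e1.
- by rewrite /img_len map_cat slen_cat -/(img_len s2) eA.
apply/agree_cat; split=> p hp x hx.
  rewrite eA in hp; rewrite -(e3 p hp (val x) hx) fE.
  have -> // : F (val x) <= 1.
  by rewrite -[leRHS]FL; apply: leF; have [_] := pieces_bound hp; move: hx => /andP[]; lra.
rewrite e1 -eF' in hp; rewrite -(e6 p hp (val x) hx) fE.
rewrite leNgt; have -> // : 1 < F (val x).
rewrite -[ltLHS]FL iF //.
by have [] := pieces_bound hp; move: hx => /andP[]; lra.
Qed.

Lemma rotates_cuts f o s1 s2 : rotates f s1 s2 ->
  exists s1' s2', s1' ++ s2' = pcuts o (s1 ++ s2) /\ rotates f s1' s2'.
Proof.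
elim: o s1 s2 => [|[c i] o IH] s1 s2 H /=; first by exists s1, s2.
rewrite cut_at_cat; case: ifP => _; apply: IH.
  exact: rotates_cutl.
exact: rotates_cutr.
Qed.

Lemma rotates_cuts_img f o s1 s2 : rotates f s1 s2 ->
  exists s1' s2' o', [/\ s2' ++ s1' = pcuts o (s2 ++ s1),
    s1' ++ s2' = pcuts o' (s1 ++ s2) & rotates f s1' s2'].
Proof.
elim: o s1 s2 => [|[c i] o IH] s1 s2 H /=; first by exists s1, s2, [::].
rewrite cut_at_cat; case: ltnP => hi.
  have [s1' [s2' [ o' [h1 h2 h3]]]] := IH _ _ (@rotates_cutr R f c i s1 s2 H).
  exists s1', s2', ((c, size s1 + i)%N :: o'); split => //.
  by rewrite h2 /= cut_at_cat ltnNge leq_addr addKn.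
have [s1' [s2' [ o' [h1 h2 h3]]]] := IH _ _ (@rotates_cutl R f c (i - size s2) s1 s2 H).
have [lt|ge] := ltnP (i - size s2) (size s1).
  exists s1', s2', ((c, i - size s2)%N :: o'); split => //.
  by rewrite h2 /= cut_at_cat lt.
by exists s1', s2', o'; split => //; rewrite h2 cut_at_out.
Qed.

(** A refinement of the trivial subdivision of (0, 1] is a tree. *)
Lemma tree_refinement s : slen s = 1 -> exists o T, ncuts o s = exps 0 T.
Proof.
move=> e; have [ o [p h]] : joinable s [:: 0%N].
  by apply: (@slen_eq_joinable R); rewrite e slen_cons slen_nil addr0.
by exists o, (attachs p Leaf); rewrite exps_attachs.
Qed.

Lemma Ttau_represents f : Ttau f -> exists T1 k T2, represents f T1 k T2.
Proof.
move=> /Ttau_rotates [s1 [s2 [h1 h2 H]]].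
have [ o [T2 e2]] := tree_refinement h1.
(* Refine until the domain is a tree; then until the image is one, which cuts
   leaves of the tree of the domain. *)
have [s1' [s2' [h H']]] := rotates_cuts o H.
have h2' : slen (map snd (s2' ++ s1')) = 1.
  rewrite map_cat slen_cat addrC -slen_cat -map_cat h (map_cuts (cB := cutn)); last by move=> [] [].
  by rewrite slen_cuts map_cat slen_cat addrC -slen_cat -map_cat.
have [p [T1 e1]] := tree_refinement h2'.
have [s1'' [s2'' [p' [hi hd H'']]]] := rotates_cuts_img p H'.
exists T1, (size s1''), (attachs p' T2), s1'', s2''; split => //.
- rewrite exps_attachs -e2 hd h !(map_cuts (cB := cutn)); try by move=> [] [].
  by [].
- by rewrite hi (map_cuts (cB := cutn)); last by move=> [] [].
Qed.

Lemma represents_modn f T1 k T2 : represents f T1 k T2 ->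
  represents f T1 (k %% nleaves T2) T2.
Proof.
move=> /represents_tripleP[n [S1 [S2 [<- <- _ ->]]]].
rewrite rotation_mod (ktreeP S2); apply: represents_triple; apply/ltnW/ltn_pmod.
by rewrite -(ktreeP S2) nleaves_gt0.
Qed.

Lemma Ttau_represents3 f : Ttau f -> exists m T1 k T2,
  [/\ nleaves T1 = m.+3, nleaves T2 = m.+3, (k < m.+3)%N & represents f T1 k T2].
Proof.
have grow T1 k T2 : represents f T1 k T2 -> exists T1' k' T2',
    represents f T1' k' T2' /\ nleaves T2' = (nleaves T2).+1.
  move=> H; have := represents_attach Xcaret H (nleaves_gt0 T2).
  by do 3!eexists; split; [eassumption|rewrite nleaves_attach ?nleaves_gt0].
move=> /Ttau_represents[T1 [k [T2 /grow [T3 [k' [T4 [/grow H e]]]]]]].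
have [T1' [k'' [T2' [{}H e']]]] := H.
have n0 := nleaves_gt0 T2.
have e'' : nleaves T2' = (nleaves T2).-1.+3 by rewrite e' e prednK.
have [e1 _] := represents_leaves H.
exists (nleaves T2).-1, T1', (k'' %% nleaves T2')%N, T2'; split => //.
- by rewrite e1.
- by rewrite e'' ltn_pmod.
exact: represents_modn.
Qed.

End RotationsInT.

(** * The presented group *)

Section Words.
Variable X : Type.

Definition winv (w : word X) : word X := rev [seq (l.1, ~~ l.2) | l <- w].

Lemma pres_winv (rel : word X -> word X -> Prop) w : pres_eq rel (w ++ winv w) [::].
Proof.
elim: w => [|[x b] w IH]; first exact: pres_refl.
rewrite /winv /= rev_cons -cats1 -/(winv w); apply: pres_trans (pres_cancel rel x b).
have := pres_cat (pres_refl rel [:: (x, b)]) (pres_cat IH (pres_refl rel [:: (x, ~~ b)])).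
by rewrite -catA.
Qed.

Lemma winvK : involutive winv.
Proof.
move=> w; rewrite /winv map_rev revK -map_comp -[RHS]map_id.
by apply: eq_map => -[x b] /=; rewrite negbK.
Qed.

Lemma word_eval_cat (G : groupType) (gen : X -> G) u v :
  word_eval gen (u ++ v) = (word_eval gen u * word_eval gen v)%g.
Proof. by elim: u => [|l u IH] /=; rewrite ?mul1g // -/(word_eval gen _) IH mulgA. Qed.

Lemma word_eval_winv (G : groupType) (gen : X -> G) u :
  word_eval gen (winv u) = (word_eval gen u)^-1%g.
Proof.
elim: u => [|[x b] u IH]; first by rewrite invg1.
rewrite /winv /= rev_cons -cats1 word_eval_cat IH invMg; congr (_ * _)%g.
by case: b; rewrite /= mulg1 ?invgK.
Qed.

Lemma pres_eq_eval (rel : word X -> word X -> Prop) (G : groupType) (gen : X -> G) :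
  (forall u v, rel u v -> word_eval gen u = word_eval gen v) ->
  forall u v, pres_eq rel u v -> word_eval gen u = word_eval gen v.
Proof.
move=> H u v; elim=> {u v}.
- by [].
- by move=> u v _ ->.
- by move=> u v w _ -> _ ->.
- by move=> u u' v v' _ e _ e'; rewrite !word_eval_cat e e'.
- by move=> x []; rewrite /= mulg1 ?mulVg ?mulgV.
- exact: H.
Qed.

End Words.

Section Presented.
Variables (X : Type) (rel : word X -> word X -> Prop).

(** An alias of the type of words that carries the classical choice structure
    required for a quotient type. *)
Definition cword : Type := word X.
HB.instance Definition _ := gen_eqMixin cword.
HB.instance Definition _ := gen_choiceMixin cword.

Let eqw (u v : cword) : bool := `[< pres_eq rel u v >].

Lemma eqw_refl : reflexive eqw.
Proof. by move=> u; apply/asboolP; exact: pres_refl. Qed.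
Lemma eqw_sym : symmetric eqw.
Proof. by move=> u v; apply/asboolP/asboolP; exact: pres_sym. Qed.
Lemma eqw_trans : transitive eqw.
Proof. by move=> v u w /asboolP h /asboolP h'; apply/asboolP; exact: pres_trans h h'. Qed.

Definition pres_equiv := EquivRel eqw eqw_refl eqw_sym eqw_trans.
Definition presented := {eq_quot pres_equiv}.
HB.instance Definition _ := Choice.on presented.

Definition pclass (w : word X) : presented := \pi_presented (w : cword).
Definition prepr (a : presented) : word X := generic_quotient.repr a.

Lemma preprK a : pclass (prepr a) = a.
Proof. exact: generic_quotient.reprK. Qed.

Lemma pclass_eq u v : pclass u = pclass v <-> pres_eq rel u v.
Proof.
split; first by move=> /eqmodP /asboolP.
by move=> h; apply/eqmodP/asboolP.
Qed.

Definition presented_mul a b := pclass (prepr a ++ prepr b).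
Definition presented_inv a := pclass (winv (prepr a)).

Lemma presented_mulE u v : presented_mul (pclass u) (pclass v) = pclass (u ++ v).
Proof. by apply/pclass_eq/pres_cat; apply/pclass_eq; exact: preprK. Qed.

Lemma presented_mulA : associative presented_mul.
Proof.
move=> a b c; rewrite -(preprK a) -(preprK b) -(preprK c).
by rewrite !presented_mulE catA.
Qed.
Lemma presented_1mul : left_id (pclass [::]) presented_mul.
Proof. by move=> a; rewrite -(preprK a) presented_mulE. Qed.
Lemma presented_mul1 : right_id (pclass [::]) presented_mul.
Proof. by move=> a; rewrite -(preprK a) presented_mulE cats0. Qed.
Lemma presented_Vmul : left_inverse (pclass [::]) presented_inv presented_mul.
Proof.
move=> a; rewrite -{2}(preprK a) presented_mulE; apply/pclass_eq.
by rewrite -{2}(winvK (prepr a)); exact: pres_winv.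
Qed.
Lemma presented_mulV : right_inverse (pclass [::]) presented_inv presented_mul.
Proof.
move=> a; rewrite -{1}(preprK a) presented_mulE; apply/pclass_eq.
exact: pres_winv.
Qed.

HB.instance Definition _ := isGroup.Build presented
  presented_mulA presented_1mul presented_mul1 presented_Vmul presented_mulV.

Definition pgen (x : X) : presented := pclass [:: lpos x].

Lemma word_eval_pgen w : word_eval pgen w = pclass w.
Proof.
elim: w => //= -[x b] w; rewrite -/(word_eval pgen w) => -> /=.
rewrite -cat1s -presented_mulE; congr presented_mul.
case: b => //; apply: (mulgI (pgen x)); rewrite mulgV.
by rewrite [RHS]presented_mulE; apply/esym/pclass_eq; exact: (pres_cancel rel x false).
Qed.

End Presented.

(** * Trivial rotations *)

Section Identity.
Variable R : realType.
Local Notation tau := (tau R).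

Lemma agree_one u v s : agree (1%g : selfbij (Ioc01 R)) (pieces u v s) ->
  0 <= u -> u + dom_len R s <= 1 -> map fst s = map snd s /\ (u = v \/ s = [::]).
Proof.
elim: s u v => [|[d r] s IH] u v /=; first by split=> //; right.
move=> /agree_cons[/= h H] u0; rewrite /dom_len /= slen_cons addrA => u1.
have d0 := tauX_gt0 R d; have s0 := slen_ge0 R (map fst s).
have [x hx] : exists x : Ioc01 R, val x = u + tau ^+ d by apply: Ioc01_ex; lra.
have [y hy] : exists y : Ioc01 R, val y = u + tau ^+ d / 2 by apply: Ioc01_ex; lra.
have := h x; rewrite hx affine_onto_len /in_oc /= => /(_ ltac:(lra)).
have := h y; rewrite hy affine_onto_len /in_oc /= => /(_ ltac:(lra)).
have -> : (u + tau ^+ d / 2 - u) / tau ^+ d = 1 / 2 by field; rewrite lt0r_neq0.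
have -> : (u + tau ^+ d - u) / tau ^+ d = 1 by field; rewrite lt0r_neq0.
move=> e1 e2.
have /eqP : tau ^+ d = tau ^+ r by lra.
rewrite eq_le !leNgt !tauX_lt -!leqNgt -eqn_leq => /eqP e; subst r.
have euv : u = v by lra.
have [||-> _] := IH _ _ H; first by lra.
  by rewrite /dom_len; lra.
by split; last left.
Qed.

(** The identity sends the first interval to an interval that starts at 0, so
    the rotation does not turn. *)
Lemma represents_id T1 k T2 : (k < nleaves T2)%N ->
  represents (1%g : selfbij (Ioc01 R)) T1 k T2 -> k = 0%N /\ exps 0 T1 = exps 0 T2.
Proof.
move=> hk [s1 [s2 [h0 h2 h1 /agree_cat[H1 H2]]]].
have e : dom_len R s1 + dom_len R s2 = 1.
  by rewrite /dom_len -slen_cat -map_cat h2 slen_exps.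
have l1 := slen_ge0 R (map fst s1); have l2 := slen_ge0 R (map fst s2).
have [|_ [h|h]] := agree_one H1 (lexx 0).
- by rewrite add0r -e lerDl.
- case: s2 h h2 {H1 H2 h1 e l2} => [_ h2|p s2].
    by move: (congr1 size h2) hk; rewrite cats0 size_map size_exps h0 => ->; rewrite ltnn.
  by move=> h; have := slen_gt0 R p.2 (map snd s2); rewrite -[slen _ _]h ltxx.
have [|h' _] := agree_one H2 l1; first by rewrite e.
by rewrite -h0 h; split => //; rewrite -h1 -h2 h cats0 h'.
Qed.

End Identity.

(** * The presentation *)

Theorem theorem2p2 (R : realType) :
  has_presentation (@Ttau R) (@Tgen_elt R) Trel.
Proof.
have M := @Tgen_model R; set elt := @Tgen_elt R in M *.
have MP : Trel_model (pgen Trel).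
  by move=> u v uv; rewrite !word_eval_pgen; apply/pclass_eq; exact: pres_rel.
split.
  apply/seteqP; split=> [f [w _ <-]|f].
    have [m [T1 [k [T2 [h1 h2 ->]]]]] := nf_word R w; last exact: M.
    exact: represents_Ttau (represents_nf R k h1 h2).
  move=> /Ttau_represents3 [m [T1 [k [T2 [h1 h2 hk H]]]]].
  have := represents_nf R k h1 h2; rewrite modn_small // => H'.
  rewrite (represents_uniq H H').
  have inM g h : range (word_eval elt) g -> range (word_eval elt) h ->
      range (word_eval elt) (g * h)%g.
    by move=> [u _ <-] [v _ <-]; exists (u ++ v); rewrite // word_eval_cat.
  have inV g : range (word_eval elt) g -> range (word_eval elt) g^-1%g.
    by move=> [u _ <-]; exists (winv u); rewrite // word_eval_winv.
  have in1 : range (word_eval elt) 1%g by exists [::].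
  have ing x : range (word_eval elt) (elt x).
    by exists [:: lpos x]; rewrite //= mulg1.
  have inT T n b : range (word_eval elt) (tree_elt elt T n b).
    elim: T n b => [|c l IHl r IHr] n b //=; apply: (inM) => //; apply: (inM) => //.
    by rewrite /cstep; case: b; [case: c => //; apply: (inV); exact: ing | exact: ing].
  apply: (inM); last exact: inV.
  apply: (inM) => //; elim: (k) => [|j IH]; first by rewrite expg0.
  by rewrite expgS; apply: (inM) => //; exact: (ing (@gc m.+1 isT)).
move=> u v; split; last exact: pres_eq_eval.
(* One normal form of u v ^-1 serves in T_tau, where it shows that k = 0 and
   that T1 and T2 have the same leaves, and in the presented group. *)
move=> euv; have [m [T1 [k [T2 [h1 h2 hw]]]]] := nf_word R (u ++ winv v).
have := represents_nf R k h1 h2; rewrite -hw // word_eval_cat word_eval_winv euv mulgV.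
move=> /represents_id [|k0 e]; first by rewrite h2 ltn_pmod.
apply/pclass_eq; rewrite -!word_eval_pgen.
apply: (mulIg (word_eval (pgen Trel) (winv v))).
rewrite -word_eval_cat word_eval_winv mulgV hw // /nf (rgenX_modn MP) k0 expg0 mulg1.
by rewrite (tree_elt_exps R MP 0 true e) mulgV.
Qed.
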